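(* Let $G$ be a connected Lie group and $n$ a positive integer. Then each element of $\mathcal{E}_n(G)$ is a closed submanifold of $G$.
   Context: Lie groups are real and finite-dimensional; $e$ is the identity element. For a positive integer $n$, $E_n(G)=\{g\in G\mid g^n=e\}$ with the subspace topology from $G$, and $\mathcal{E}_n(G)$ denotes the set of all connected components of $E_n(G)$. A closed submanifold is an embedded submanifold that is closed as a subset of $G$. (Different elements of $\mathcal{E}_n(G)$ may have different dimensions.) *)

(* Defs.v *)
From HB Require Import structures.
From mathcomp Require Import all_boot all_order all_algebra.
From mathcomp Require Import all_classical all_reals all_analysis.
Set Implicit Arguments.
Unset Strict Implicit.
Unset Printing Implicit Defensive.
Import Order.TTheory GRing.Theory Num.Theory.
Import numFieldNormedType.Exports.
Local Open Scope classical_set_scope.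
Local Open Scope ring_scope.

(* [U] is always open where this is used, so that the values of [f] outside
   of [U] are irrelevant. *)
Fixpoint Ck_on (R : realType) (V W : normedModType R) (k : nat) (U : set V)
    (f : V -> W) : Prop :=
  match k with
  | 0 => {in U, continuous f}
  | k'.+1 => {in U, forall x, differentiable f x} /\
             forall v : V, Ck_on k' U (fun x => 'D_v f x)
  end.

Definition smooth_on (R : realType) (V W : normedModType R) (U : set V)
    (f : V -> W) : Prop :=
  forall k, Ck_on k U f.

(* A homeomorphism from the open set [chart_dom] onto an open subset of [E];
   both maps are total, with irrelevant values outside of these open sets. *)
Record chart (R : realType) (T : topologicalType) (E : normedModType R) := Chart {
  chart_dom : set T;
  chart_fun :> T -> E;
  chart_inv : E -> T;
  chart_dom_open : open chart_dom;
  chart_cod_open : open (chart_fun @` chart_dom);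
  chartK : {in chart_dom, cancel chart_fun chart_inv};
  chart_continuous : {in chart_dom, continuous chart_fun};
  chart_inv_continuous : {in chart_fun @` chart_dom, continuous chart_inv}
}.

Definition chart_cod (R : realType) (T : topologicalType) (E : normedModType R)
    (phi : chart T E) : set E :=
  phi @` chart_dom phi.

Definition compatible_charts (R : realType) (T : topologicalType)
    (E : normedModType R) (phi psi : chart T E) : Prop :=
  smooth_on (phi @` (chart_dom phi `&` chart_dom psi)) (psi \o chart_inv phi) /\
  smooth_on (psi @` (chart_dom phi `&` chart_dom psi)) (phi \o chart_inv psi).

(* The conditions below for charts of (not necessarily maximal) atlases [A]
   and [B] imply the same for all charts that are compatible with them. *)
Definition smooth_map (R : realType) (S T : topologicalType)
    (E F : normedModType R) (A : set (chart S E)) (B : set (chart T F))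
    (f : S -> T) : Prop :=
  continuous f /\
  forall phi psi, A phi -> B psi ->
    smooth_on (chart_cod phi `&` [set x | chart_dom psi (f (chart_inv phi x))])
              (psi \o f \o chart_inv phi).

Section prod_chart.
Context (R : realType) (S T : topologicalType) (E F : normedModType R).
Variables (phi : chart S E) (psi : chart T F).

Let dom := chart_dom phi `*` chart_dom psi.
Let fn (z : S * T) : E * F := (phi z.1, psi z.2).
Let inv (z : E * F) : S * T := (chart_inv phi z.1, chart_inv psi z.2).

Let openX (X Y : topologicalType) (A : set X) (B : set Y) :
  open A -> open B -> open (A `*` B).
Proof.
move=> oA oB; rewrite openE => -[x y] [/= Ax By].
by exists (A, B) => //; split; exact: open_nbhs_nbhs.
Qed.

Let fn_dom : fn @` dom = chart_cod phi `*` chart_cod psi.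
Proof.
apply/seteqP; split=> [_ [[x y] [/= dx dy] <-]|[_ _] [/= [x dx <-] [y dy <-]]].
  by split; [exists x | exists y].
by exists (x, y).
Qed.

Let prod_dom_open : open dom.
Proof. by apply: openX; exact: chart_dom_open. Qed.

Let prod_cod_open : open (fn @` dom).
Proof. by rewrite fn_dom; apply: openX; exact: chart_cod_open. Qed.

Let prodK : {in dom, cancel fn inv}.
Proof.
by move=> -[x y] /set_mem[/= dx dy]; rewrite /inv /= !chartK//; exact: mem_set.
Qed.

Let prod_continuous : {in dom, continuous fn}.
Proof.
move=> -[x y] /set_mem[/= dx dy].
apply: cvg_pair => /=; [apply: (@cvg_comp _ _ _ fst phi _ (nbhs x))
                       |apply: (@cvg_comp _ _ _ snd psi _ (nbhs y))].
- exact: cvg_fst.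
- exact/chart_continuous/mem_set.
- exact: cvg_snd.
- exact/chart_continuous/mem_set.
Qed.

Let prod_inv_continuous : {in fn @` dom, continuous inv}.
Proof.
rewrite fn_dom => -[x y] /set_mem[/= dx dy].
apply: cvg_pair => /=; [apply: (@cvg_comp _ _ _ fst (chart_inv phi) _ (nbhs x))
                       |apply: (@cvg_comp _ _ _ snd (chart_inv psi) _ (nbhs y))].
- exact: cvg_fst.
- exact/chart_inv_continuous/mem_set.
- exact: cvg_snd.
- exact/chart_inv_continuous/mem_set.
Qed.

Definition prod_chart : chart (S * T)%type (E * F)%type :=
  Chart prod_dom_open prod_cod_open prodK prod_continuous prod_inv_continuous.

End prod_chart.

Definition prod_atlas (R : realType) (S T : topologicalType)
    (E F : normedModType R) (A : set (chart S E)) (B : set (chart T F)) :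
    set (chart (S * T)%type (E * F)%type) :=
  [set prod_chart phi psi | phi in A & psi in B].

HB.mixin Record Topological_isManifold (R : realType) (d : nat) M
    & Topological M := {
  atlas : set (chart M 'rV[R]_d);
  atlas_cover : \bigcup_(phi in atlas) chart_dom phi = [set: M];
  atlas_compatible : forall phi psi, atlas phi -> atlas psi ->
    compatible_charts phi psi;
  manifold_hausdorff : hausdorff_space M;
  manifold_second_countable : @second_countable M
}.

#[short(type="manifoldType")]
HB.structure Definition Manifold (R : realType) (d : nat) :=
  {M of Topological M & Topological_isManifold R d M}.

HB.mixin Record ManifoldGroup_isLieGroup (R : realType) (d : nat) G
    & Manifold R d G & Group G := {
  mulg_smooth : smooth_map (prod_atlas (@atlas R d G) (@atlas R d G))
                  (@atlas R d G) (fun z : G * G => (z.1 * z.2)%g);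
  invg_smooth : smooth_map (@atlas R d G) (@atlas R d G) (fun g : G => g^-1%g)
}.

#[short(type="lieGroupType")]
HB.structure Definition LieGroup (R : realType) (d : nat) :=
  {G of Manifold R d G & Group G & ManifoldGroup_isLieGroup R d G}.

(* The charts of the maximal atlas. *)
Definition admissible_chart (R : realType) (d : nat) (M : manifoldType R d)
    (phi : chart M 'rV[R]_d) : Prop :=
  forall psi, @atlas R d M psi -> compatible_charts phi psi.

(* Slice charts; the dimension [k] is the same around all points of [S]. *)
Definition embedded_submanifold (R : realType) (d : nat) (M : manifoldType R d)
    (S : set M) : Prop :=
  exists2 k : nat, (k <= d)%N &
    forall p, S p -> exists phi : chart M 'rV[R]_d,
      [/\ admissible_chart phi, chart_dom phi p &
          phi @` (chart_dom phi `&` S) =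
          chart_cod phi `&`
            [set x | forall i : 'I_d, (k <= i)%N -> x ord0 i = 0] ].

Definition closed_submanifold (R : realType) (d : nat) (M : manifoldType R d)
    (S : set M) : Prop :=
  embedded_submanifold S /\ closed S.

Definition torsion_set (R : realType) (d : nat) (G : lieGroupType R d)
    (n : nat) : set G :=
  [set g : G | (g ^+ n)%g = 1%g].
Arguments torsion_set {R d} G n.

Definition torsion_components (R : realType) (d : nat) (G : lieGroupType R d)
    (n : nat) : set (set G) :=
  [set connected_component (torsion_set G n) g | g in torsion_set G n].
Arguments torsion_components {R d} G n.

(* Main.v *)
Require Import Defs.
From HB Require Import structures.
From mathcomp Require Import all_boot all_order all_algebra.
From mathcomp Require Import all_classical all_reals all_analysis.
From mathcomp Require Import ring lra.
Set Implicit Arguments.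
Unset Strict Implicit.
Unset Printing Implicit Defensive.
Import Order.TTheory GRing.Theory Num.Theory.
Import numFieldNormedType.Exports.
Local Open Scope classical_set_scope.
Local Open Scope ring_scope.

(** Let g ^ n = 1, and let A be the differential at 1 of y |-> g^-1 y g, read in
a chart at the identity.  Since conjugation by g ^ n is trivial, A ^ n = 1, so
that R^d is the direct sum of ker(A - 1) and im(A - 1): the mean of the powers
of A is the projection on the first summand [finite_order_split].

Let t be the inverse of the chart, recentred so that t 0 = 1, and write u and v
for the components of x in ker(A - 1) and im(A - 1).  The map
[Psi x = t v * g * t u * (t v)^-1] is such that x |-> g^-1 * Psi x has
differential v A + u - v at 0, which is invertible; by the inverse function
theorem [smooth_inverse], Psi is the inverse of a chart around g.  The n-th
power of Psi x is conjugate to (g * t u) ^ n, and the differential of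
u |-> (g * t u) ^ n at 0 is 1 + A + ... + A ^ (n - 1), which is multiplication
by n on ker(A - 1).  Hence, close to 0, Psi x is a torsion point if and only if
u = 0, and in suitable linear coordinates this is a slice [torsion_slice].

On that slice Psi x is the conjugate t v * g * (t v)^-1 of g.  So conjugacy
classes are open in the torsion set and each connected component lies in a
single class [torsion_component_conj].  The slice chart at g is carried to every
other point of the component by a conjugation, hence all slices have the same
dimension.  Finally these charts have balls as codomains, and the slice of a
ball is star-shaped, so that near any of its points the component is all of the
torsion set [slice_connected]. *)

(** * Calculus of maps of class C^k *)

(** Named so that a linear structure can be attached to it. *)
Definition mx_coord (R : realType) m n (i : 'I_m) (j : 'I_n)
  (A : 'M[R]_(m, n)) : R := A i j.

Lemma mx_coord_linear (R : realType) m n (i : 'I_m) (j : 'I_n) :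
  linear (mx_coord i j : 'M[R]_(m, n) -> R).
Proof. by move=> a A B; rewrite /mx_coord !mxE. Qed.

HB.instance Definition _ (R : realType) m n i j := GRing.isLinear.Build R
  'M[R]_(m, n) R _ (@mx_coord R m n i j) (@mx_coord_linear R m n i j).

Section Ck.
Context {R : realType}.
Implicit Types V W X Y : normedModType R.

(** Differentiability is a local property: the remainders of [f] and [g] at
[a] agree near 0. *)
Lemma near_eq_differentiable V W (f g : V -> W) (a : V) :
  (\near a, f a = g a) -> differentiable f a -> differentiable g a.
Proof.
move=> fg df.
have fga : f a = g a := nbhs_singleton fg.
have dfg : g \o shift a = cst (g a) + 'd f a +o_ 0 id.
  apply/eqaddoP => _/posnumP[e].
  have /eqaddoP/(_ e%:num) := diff_locally df.
  move=> /(_ ltac:(by [])) h.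
  have : \forall h \near (0 : V), f (h + a) = g (h + a).
    move: fg; rewrite (near_shift 0 a).
    by apply: filterS => x /=; rewrite subr0.
  move: h; apply: filterS2 => x /= + e1.
  by rewrite !fctE /= e1 fga.
have ddf : 'd g a = 'd f a :> (V -> W).
  by apply: diff_unique => //; exact: diff_continuous.
apply/diff_locallyP; rewrite ddf; split => //; exact: diff_continuous.
Qed.

Lemma Ck_onS V W k (U U' : set V) (f : V -> W) :
  U' `<=` U -> Ck_on k U f -> Ck_on k U' f.
Proof.
elim: k f => [|k IH] f UU /=.
  by move=> h x /set_mem /UU /mem_set /h.
move=> [df h]; split=> [x /set_mem /UU /mem_set /df //|v].
exact: IH.
Qed.

(** The conditions in [Ck_on] are pointwise, since the derivatives are
globally defined functions. *)
Lemma Ck_on_local V W k (U : set V) (f : V -> W) :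
  (forall x, U x -> exists2 U', U' x & Ck_on k U' f) -> Ck_on k U f.
Proof.
elim: k f => [|k IH] f h /=.
  by move=> x /set_mem/h [U' /mem_set xU'] /(_ x xU').
split=> [x /set_mem/h [U' /mem_set xU' [/(_ x xU')]]//|v].
by apply: IH => x /h[U' xU' [_ /(_ v)]]; exists U'.
Qed.

(** In contrast with the previous lemmas the openness of [U] matters: it is
what makes [f] and [g] have the same derivatives at the points of [U]. *)
Lemma Ck_on_eq V W k (U : set V) (f g : V -> W) : open U ->
  {in U, f =1 g} -> Ck_on k U f -> Ck_on k U g.
Proof.
move=> oU; elim: k f g => [|k IH] f g fg /=.
  move=> h x xU; rewrite /continuous_at -(fg x xU).
  apply: cvg_trans (h x xU); apply: near_eq_cvg.
  have : nbhs x U by apply: open_nbhs_nbhs; split => //; exact/set_mem.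
  by apply: filterS => y /mem_set /fg.
have nfg x : x \in U -> \near x, f x = g x.
  move=> xU; have : nbhs x U.
    by apply: open_nbhs_nbhs; split => //; exact/set_mem.
  by apply: filterS => y /mem_set /fg.
move=> [df h]; split=> [x xU|v].
  exact: (near_eq_differentiable (nfg x xU) (df x xU)).
apply: IH (h v) => x xU; exact/near_eq_derive/nfg.
Qed.

Lemma Ck_onW V W k (U : set V) (f : V -> W) : Ck_on k.+1 U f -> Ck_on k U f.
Proof.
elim: k f => [|k IH] f /= [df h].
  by move=> x /df; exact: differentiable_continuous.
by split=> // v; apply: IH; exact: h.
Qed.

Lemma Ck_on_cst V W k (U : set V) (a : W) : Ck_on k U (fun=> a : W).
Proof.
elim: k a => [|k IH] a /=; first by move=> x _; exact: cvg_cst.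
split=> [x _|v]; first exact: differentiable_cst.
have -> : (fun x : V => 'D_v (fun=> a) x) = fun=> 0.
  by apply/funext => x; exact: derive_cst.
exact: IH.
Qed.

Lemma Ck_on_lin V W k (U : set V) (l : {linear V -> W}) :
  continuous l -> Ck_on k U l.
Proof.
move=> cl; case: k => [|k]; first by move=> x _; exact: cl.
split=> [x _|v]; first exact: linear_differentiable.
have -> : (fun x : V => 'D_v l x) = fun=> l v.
  apply/funext => x; rewrite deriveE; last exact: linear_differentiable.
  by rewrite diff_lin.
exact: Ck_on_cst.
Qed.

(** Post-composition with a linear map does not require the chain rule for
higher derivatives, because directional derivatives commute with it.  It
serves to prove the general composition lemma [Ck_on_comp] below. *)
Lemma Ck_on_lincomp V W X k (U : set V) (l : {linear W -> X}) (f : V -> W) :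
  open U -> continuous l -> Ck_on k U f -> Ck_on k U (l \o f).
Proof.
move=> oU cl; elim: k f => [|k IH] f /=.
  by move=> cf x xU; apply: continuous_comp; [exact: cf|exact: cl].
move=> [df h]; split=> [x xU|v].
  by apply: differentiable_comp; [exact: df|exact: linear_differentiable].
apply: (Ck_on_eq oU _ (IH _ (h v))) => x xU /=.
have dl : differentiable l (f x) by exact: linear_differentiable.
have dfx := df x xU.
rewrite deriveE // [RHS]deriveE; last exact: differentiable_comp.
by rewrite (diff_comp dfx dl) /= diff_lin.
Qed.

Lemma Ck_onD V W k (U : set V) (f g : V -> W) : open U ->
  Ck_on k U f -> Ck_on k U g -> Ck_on k U (fun x => f x + g x).
Proof.
move=> oU; elim: k f g => [|k IH] f g /=.
  by move=> cf cg x xU; apply: continuousD; [exact: cf|exact: cg].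
move=> [df hf] [dg hg]; split=> [x xU|v].
  by apply: differentiableD; [exact: df|exact: dg].
apply: (Ck_on_eq oU _ (IH _ _ (hf v) (hg v))) => x xU /=.
by rewrite -deriveD //; apply: diff_derivable; [exact: df|exact: dg].
Qed.

Lemma Ck_on_sum V W k (U : set V) (I : Type) (r : seq I) (F : I -> V -> W) :
  open U -> (forall i, Ck_on k U (F i)) ->
  Ck_on k U (fun x => \sum_(i <- r) F i x).
Proof.
move=> oU hF; elim: r => [|i r IH].
  rewrite (_ : (fun _ => _) = fun=> 0); first exact: Ck_on_cst.
  by apply/funext => x; rewrite big_nil.
rewrite (_ : (fun _ => _) = fun x => F i x + \sum_(j <- r) F j x).
  exact: Ck_onD.
by apply/funext => x; rewrite big_cons.
Qed.

Lemma is_diff_scale V W (h : V -> R) (f : V -> W) x :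
  differentiable h x -> differentiable f x ->
  differentiable (fun y => h y *: f y) x /\
  forall v, 'd (fun y => h y *: f y) x v = h x *: 'd f x v + 'd h x v *: f x.
Proof.
move=> dh df.
pose s := (fun (a : R) (w : W) => a *: w).
have bs : bilinear_for (GRing.Scale.Law.clone _ _ *:%R _)
   (GRing.Scale.Law.clone _ _ *:%R _) s.
  split=> [w|a] b x1 x2 /=; first by rewrite /s scalerDl scalerA.
  by rewrite /s scalerDr !scalerA mulrC.
pose sM := bilinear_isBilinear.Build _ _ _ _ _ _ s bs.
pose S : {bilinear _ -> _ -> _} := HB.pack s sM.
have cS : continuous (fun p => S p.1 p.2) by exact: scale_continuous.
have dp := differentiable_pair dh df.
have dS := differentiable_bilin (h x, f x) cS.
split; first exact: (differentiable_comp dp dS).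
move=> v; pose hf y := (h y, f y).
rewrite (_ : (fun y => h y *: f y) = (fun p => S p.1 p.2) \o hf)//.
rewrite (diff_comp dp dS).
have := diff_bilin (h x, f x) cS => /(congr1 (@^~ ('d hf x v))).
by rewrite /= => ->; rewrite diff_pair.
Qed.

Lemma Ck_onZ V W k (U : set V) (h : V -> R) (f : V -> W) : open U ->
  Ck_on k U h -> Ck_on k U f -> Ck_on k U (fun x => h x *: f x).
Proof.
move=> oU; elim: k h f => [|k IH] h f.
  by move=> /= ch cf x xU; apply: continuousZ; [exact: ch|exact: cf].
move=> kh kf; have kh' := Ck_onW kh; have kf' := Ck_onW kf.
move: kh kf => /= [dh hh] [df hf]; split=> [x xU|v].
  by have [] := is_diff_scale (dh x xU) (df x xU).
apply: (Ck_on_eq oU _ (Ck_onD oU (IH _ _ kh' (hf v)) (IH _ _ (hh v) kf'))).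
move=> x xU /=; have [d1 d2] := is_diff_scale (dh x xU) (df x xU).
have d3 := dh x xU; have d4 := df x xU.
by rewrite [RHS]deriveE// d2 !deriveE.
Qed.

Lemma Ck_on_pair V W X k (U : set V) (f : V -> W) (g : V -> X) : open U ->
  Ck_on k U f -> Ck_on k U g -> Ck_on k U (fun x => (f x, g x)).
Proof.
move=> oU; elim: k f g => [|k IH] f g /=.
  by move=> cf cg x xU; apply: cvg_pair; [exact: cf|exact: cg].
move=> [df hf] [dg hg]; split=> [x xU|v].
  by apply: differentiable_pair; [exact: df|exact: dg].
apply: (Ck_on_eq oU _ (IH _ _ (hf v) (hg v))) => x xU /=.
have d1 := df x xU; have d2 := dg x xU.
by rewrite [RHS]deriveE ?diff_pair// ?deriveE//; exact: differentiable_pair.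
Qed.

(** A finite coordinate system.  Stating finite-dimensionality in this form
covers both matrices and products of such spaces without fixing a numbering of
the coordinates. *)
Definition findim W : Prop := exists (I : finType) (e : I -> W)
  (c : I -> {linear W -> R}), (forall i, continuous (c i)) /\
  forall w, w = \sum_i c i w *: e i.

(** A linear map is a combination of the coordinates, which are continuous. *)
Lemma lin_continuous V W (l : {linear V -> W}) : findim V -> continuous l.
Proof.
move=> [I [e [c [cc we]]]].
rewrite (_ : (l : V -> W) = fun x => \sum_i c i x *: l (e i)).
  have H := @Ck_on_sum V W 0%N setT _ (index_enum I)
    (fun i x => c i x *: l (e i)) openT.
  move=> x; apply: H; last exact: mem_setT.
  by move=> i; apply: Ck_onZ; [exact: openT|exact: Ck_on_lin|exact: Ck_on_cst].
apply/funext => x; rewrite [in LHS](we x) linear_sum.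
by apply: eq_bigr => i _; rewrite linearZ.
Qed.

Lemma findim_mx m n : findim 'M[R]_(m, n).
Proof.
exists ('I_m * 'I_n)%type, (fun p => delta_mx p.1 p.2).
exists (fun p => mx_coord p.1 p.2).
split; first by move=> p; exact: coord_continuous.
move=> A; rewrite [LHS]matrix_sum_delta pair_bigA /=.
exact: eq_bigr.
Qed.

Lemma findim_prod V W : findim V -> findim W -> findim (V * W)%type.
Proof.
move=> [I [e [c [cc ve]]]] [J [e' [c' [cc' we]]]].
pose E (s : I + J) : V * W :=
  match s with inl i => (e i, 0) | inr j => (0, e' j) end.
have l1 i : linear (fun z : V * W => c i z.1).
  by move=> a u v; rewrite /= linearP.
have l2 i : linear (fun z : V * W => c' i z.2).
  by move=> a u v; rewrite /= linearP.
pose M1 i := GRing.isLinear.Build _ _ _ _ _ (l1 i).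
pose M2 i := GRing.isLinear.Build _ _ _ _ _ (l2 i).
pose L1 i : {linear (V * W)%type -> R} :=
  HB.pack (fun z : V * W => c i z.1) (M1 i).
pose L2 i : {linear (V * W)%type -> R} :=
  HB.pack (fun z : V * W => c' i z.2) (M2 i).
exists (I + J)%type, E,
  (fun s => match s with inl i => L1 i | inr j => L2 j end).
split.
  case=> i z /=; (apply: continuous_comp; [|by [exact: cc|exact: cc']]).
    exact: cvg_fst.
  exact: cvg_snd.
move=> [v w]; rewrite big_sumType /=.
have -> : \sum_i c i v *: (e i, 0 : W) = (v, 0).
  rewrite [in RHS](ve v).
  elim/big_rec2 : _ => [//|i x y _ ->].
  by rewrite -[_ *: (_, _)]/(_, _) scaler0 -[LHS]/(_, _) addr0.
have -> : \sum_i c' i w *: (0 : V, e' i) = (0, w).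
  rewrite [in RHS](we w).
  elim/big_rec2 : _ => [//|i x y _ ->].
  by rewrite -[_ *: (_, _)]/(_, _) scaler0 -[LHS]/(_, _) addr0.
by rewrite -[RHS]/(_, _) addr0 add0r.
Qed.

(** Expanding the direction 'D_v f x in coordinates turns the chain rule into
'D_v (g \o f) x = \sum_i c_i('D_v f x) *: 'D_(e_i) g (f x), an expression in
finitely many fixed directions [e i], to which the induction hypothesis
applies. Without coordinates the direction of differentiation of [g] would
vary with [x], about which [Ck_on] says nothing. *)
Lemma Ck_on_comp V W X k (U : set V) (U' : set W) (g : W -> X) (f : V -> W) :
  findim W -> open U -> open U' -> (forall x, U x -> U' (f x)) ->
  Ck_on k U f -> Ck_on k U' g -> Ck_on k U (g \o f).
Proof.
move=> [I [e [c [cc we]]]] oU oU' UU'; elim: k g f UU' => [|k IH] g f UU'.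
  move=> /= cf cg x xU; apply: continuous_comp; first exact: cf.
  exact/cg/mem_set/UU'/set_mem.
move=> kf; have kf' := Ck_onW kf; move: kf => /= [df hf] [dg hg].
have dg' x : x \in U -> differentiable g (f x).
  by move=> xU; exact/dg/mem_set/UU'/set_mem.
split=> [x xU|v].
  by apply: differentiable_comp; [exact: df|exact: dg'].
have : Ck_on k U (fun x => \sum_i (c i \o (fun y => 'D_v f y)) x *:
                     ((fun y => 'D_(e i) g y) \o f) x).
  apply: Ck_on_sum => // i; apply: Ck_onZ => //; first exact: Ck_on_lincomp.
  exact: IH.
apply: Ck_on_eq => // x xU /=.
have d1 := df x xU; have d2 := dg' x xU.
rewrite [RHS]deriveE; last exact: differentiable_comp.
rewrite (diff_comp d1 d2) /= [in RHS](we ('d f x v)) linear_sum.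
by apply: eq_bigr => i _; rewrite linearZ !deriveE.
Qed.

Lemma Ck_onM V k (U : set V) (f g : V -> R) : open U ->
  Ck_on k U f -> Ck_on k U g -> Ck_on k U (fun x => f x * g x).
Proof. exact: Ck_onZ. Qed.

Lemma Ck_on_prod V k (U : set V) (I : Type) (r : seq I) (F : I -> V -> R) :
  open U -> (forall i, Ck_on k U (F i)) ->
  Ck_on k U (fun x => \prod_(i <- r) F i x).
Proof.
move=> oU hF; elim: r => [|i r IH].
  rewrite (_ : (fun _ => _) = fun=> 1); first exact: Ck_on_cst.
  by apply/funext => x; rewrite big_nil.
rewrite (_ : (fun _ => _) = fun x => F i x * \prod_(j <- r) F j x).
  exact: Ck_onM.
by apply/funext => x; rewrite big_cons.
Qed.

Lemma Ck_onV V k (U : set V) (f : V -> R) : open U ->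
  (forall x, U x -> f x != 0) ->
  Ck_on k U f -> Ck_on k U (fun x => (f x)^-1).
Proof.
move=> oU f0; elim: k f f0 => [|k IH] f f0.
  by move=> /= cf x xU; apply: continuousV; [exact/f0/set_mem|exact: cf].
move=> kf; have kf' := IH _ f0 (Ck_onW kf); move: kf => /= [df hf].
split=> [x xU|v].
  by apply: differentiableV; [exact: df|exact/f0/set_mem].
have := Ck_onM oU (@Ck_on_cst V R k U (-1))
  (Ck_onM oU (Ck_onM oU kf' kf') (hf v)).
apply: Ck_on_eq => // x xU /=.
have d := df x xU; have n0 := f0 x (set_mem xU).
rewrite [RHS]deriveV//; last exact: diff_derivable.
by rewrite mulN1r -mulNr -exprVn expr2.
Qed.

Lemma Ck_on_det V k (U : set V) n (A : V -> 'M[R]_n) : open U ->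
  (forall i j, Ck_on k U (fun x => A x i j)) -> Ck_on k U (fun x => \det (A x)).
Proof.
move=> oU hA; apply: Ck_on_sum => // s.
by apply: Ck_onM => //; [exact: Ck_on_cst|exact: Ck_on_prod].
Qed.

Lemma Ck_on_mx V k (U : set V) m n (A : V -> 'M[R]_(m, n)) : open U ->
  (forall i j, Ck_on k U (fun x => A x i j)) -> Ck_on k U A.
Proof.
move=> oU hA.
have : Ck_on k U
    (fun x => \sum_i \sum_j A x i j *: (delta_mx i j : 'M[R]_(m, n))).
  do 2 (apply: Ck_on_sum => // ?); apply: Ck_onZ => //; exact: Ck_on_cst.
by apply: Ck_on_eq => // x _; rewrite -matrix_sum_delta.
Qed.

Lemma Ck_on_coord V k (U : set V) m n (A : V -> 'M[R]_(m, n)) i j : open U ->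
  Ck_on k U A -> Ck_on k U (fun x => A x i j).
Proof.
move=> oU; apply: (@Ck_on_lincomp _ _ _ k U (mx_coord i j)) => //.
exact: coord_continuous.
Qed.

Lemma Ck_on_mulmx V k (U : set V) m n p (B : 'M[R]_(m, n))
    (A : V -> 'M[R]_(n, p)) :
  open U -> Ck_on k U A -> Ck_on k U (fun x => B *m A x).
Proof.
move=> oU; apply: (@Ck_on_lincomp _ _ _ k U (mulmx B)) => //.
exact/lin_continuous/findim_mx.
Qed.

(** By Cramer's rule the entries of the inverse are rational functions of
those of the matrix. *)
Lemma Ck_on_invmx V k (U : set V) n (A : V -> 'M[R]_n) : open U ->
  (forall x, U x -> A x \in unitmx) -> Ck_on k U A ->
  Ck_on k U (fun x => invmx (A x)).
Proof.
move=> oU uA kA.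
have : Ck_on k U (fun x => (\det (A x))^-1 *: \adj (A x)).
  apply: Ck_onZ => //.
    apply: Ck_onV => //; first by move=> x /uA; rewrite unitmxE unitfE.
    by apply: Ck_on_det => // i j; exact: Ck_on_coord.
  apply: Ck_on_mx => // i j.
  have : Ck_on k U (fun x => (-1) ^+ (j + i) * \det (row' j (col' i (A x)))).
    apply: Ck_onM => //; first exact: Ck_on_cst.
    apply: Ck_on_det => // a b.
    have : Ck_on k U (fun x => A x (lift j a) (lift i b)) by exact: Ck_on_coord.
    by apply: Ck_on_eq => // x _; rewrite !mxE.
  by apply: Ck_on_eq => // x _; rewrite mxE.
by apply: Ck_on_eq => // x xU; rewrite /invmx uA//; exact: set_mem.
Qed.

End Ck.

(** * The inverse function theorem *)

(** Joins the complete and the normed structures of matrices, as the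
contraction principle requires. *)
HB.instance Definition _ (R : realType) m n := Complete.on 'M[R]_(m, n).

Section IFT.
Context {R : realType}.
Implicit Types V W : normedModType R.

Lemma mx_norm_coord m n (A : 'M[R]_(m, n)) i j : `|A i j| <= `|A|.
Proof.
rewrite [leRHS]/Num.Def.normr /= mx_normrE.
exact: (le_bigmax _ (fun p : 'I_m * 'I_n => `|A p.1 p.2|) (i, j)).
Qed.

Lemma mx_norm_leP m n (A : 'M[R]_(m, n)) (c : R) : 0 <= c ->
  (forall i j, `|A i j| <= c) -> `|A| <= c.
Proof.
move=> c0 h; rewrite [leLHS]/Num.Def.normr /= mx_normrE.
by apply/bigmax_leP; split => // -[i j] _ /=.
Qed.

(** The mean value theorem is applied to each entry of [f] separately along
the segment; this loses nothing because the norm of matrices is the maximum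
norm. *)
Lemma mean_value_ineq V m n (f : V -> 'M[R]_(m, n)) (x y : V) (C : R) :
  0 <= C ->
  (forall t : R, 0 <= t <= 1 -> differentiable f (t *: (x - y) + y) /\
     `|'d f (t *: (x - y) + y) (x - y)| <= C) ->
  `|f x - f y| <= C.
Proof.
move=> C0 h; apply: mx_norm_leP => // i j; rewrite !mxE.
pose a := fun t : R => t *: (x - y) + y.
have da t : is_diff t a ( *:%R ^~ (x - y)).
  have := is_diffD (is_diff_scalel t (x - y)) (is_diff_cst y t).
  by rewrite addr0.
pose c : {linear 'M[R]_(m, n) -> R} := mx_coord i j.
have cc : continuous c by exact: coord_continuous.
pose phi := c \o f \o a.
have dphi (t : R) : 0 <= t <= 1 ->
    is_diff t phi (fun s => c ('d f (a t) (s *: (x - y)))).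
  move=> /h [df _].
  have d2 : is_diff (f (a t)) c c.
    by split; [exact: linear_differentiable|rewrite diff_lin].
  have := is_diff_comp (da t) (is_diff_comp (differentiableP df) d2).
  exact.
have dphi1 (t : R) : 0 <= t <= 1 -> is_derive t 1 phi (c ('d f (a t) (x - y))).
  move=> /dphi [d1 d2]; split; first exact: diff_derivable.
  by rewrite deriveE// d2 scale1r.
have [||t + e] :=
  @MVT_segment R phi (fun t => c ('d f (a t) (x - y))) 0 1 ler01.
- move=> t; rewrite in_itv /= => /andP[t0 t1]; apply: dphi1.
  by rewrite !ltW.
- apply: continuous_in_subspaceT => t; rewrite inE /= in_itv /= => /dphi [d1 _].
  exact: differentiable_continuous.
rewrite in_itv /= => /h [_ le].
move: e; rewrite subr0 mulr1 /phi /= /a scale0r add0r scale1r subrK => ->.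
exact: le_trans (mx_norm_coord _ _ _) le.
Qed.

(** Continuity of the partial derivatives makes the whole differential small
near [x0], uniformly in the direction: it is a combination of [d] of them. *)
Lemma small_diff W d (g : 'rV[R]_d -> W) (U : set 'rV[R]_d) x0 (eps : R) :
  open U -> U x0 -> Ck_on 1 U g -> (forall v, 'D_v g x0 = 0) -> 0 < eps ->
  exists2 r : R, 0 < r & ball x0 r `<=` U /\
    forall x, ball x0 r x -> forall v, `|'d g x v| <= eps * `|v|.
Proof.
move=> oU Ux0 [/= dg cg] g0 e0.
(* Dividing by [d.+1] rather than by [d] covers the case [d = 0]. *)
pose e1 := eps / d.+1%:R.
have e10 : 0 < e1 by rewrite divr_gt0.
have : \forall x \near x0,
    U x /\ forall j : 'I_d, `|'D_(delta_mx 0 j) g x| <= e1.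
  near=> x; split.
    by near: x; apply: open_nbhs_nbhs.
  near: x; apply: filter_forall => j.
  have /cvgrPdist_le /(_ _ e10) := cg (delta_mx 0 j) x0 (mem_set Ux0).
  by rewrite g0; apply: filterS => x; rewrite sub0r normrN.
move=> /nbhs_ballP[r r0 h]; exists r => //; split=> [x /h []//|x /h [Ux hx] v].
have dx := dg x (mem_set Ux).
rewrite {1}(row_sum_delta v) linear_sum; apply: le_trans (ler_norm_sum _ _ _) _.
apply: (@le_trans _ _ (\sum_(j < d) `|v| * e1)).
  apply: ler_sum => j _; rewrite linearZ normrZ ler_pM//.
    exact: mx_norm_coord.
  by rewrite -deriveE//; exact: hx.
have ed : e1 *+ d <= eps.
  rewrite -mulr_natr /e1 -mulrA ler_piMr// ?ltW// mulrC ltr_pdivrMr//.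
  by rewrite mul1r ltr_nat.
by rewrite sumr_const card_ord -mulrnAr mulrC ler_wpM2r.
Unshelve. all: by end_near. Qed.

(** If [f z - f x = (z - x) *m J + o(z - x)], then substituting [z = h y] and
multiplying by the inverse of [J] gives the expansion of [h] at [f x]; the
Lipschitz bound turns o(h y - x) into o(y - f x). *)
Lemma is_diff_inverse d (f h : 'rV[R]_d -> 'rV[R]_d) (x : 'rV[R]_d) (K : R) :
  differentiable f x -> jacobian f x \in unitmx -> h (f x) = x ->
  (\forall y \near f x, f (h y) = y /\ `|h y - x| <= K * `|y - f x|) ->
  is_diff (f x) h (fun v => v *m invmx (jacobian f x)).
Proof.
move=> df uJ hfx nh; set J := jacobian f x.
pose l : {linear 'rV[R]_d -> 'rV[R]_d} := mulmxr (invmx J).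
have cl : continuous l by exact/lin_continuous/findim_mx.
have [k k0 hk] := linear_lipschitz cl.
(* The constant may be enlarged to a positive one, so as to divide by it. *)
wlog K0 : K nh / 0 < K.
  move=> H; apply: (H (`|K| + 1)); last by rewrite ltr_wpDl.
  apply: filterS nh => y [-> /le_trans h1]; split=> //; apply: h1.
  by rewrite ler_wpM2r// (le_trans (ler_norm K))// lerDl.
have ch : h @ f x --> x.
  move=> A /nbhs_ballP[e /= e0 hA].
  have e1 : 0 < e / K by rewrite divr_gt0.
  have nb : nbhs (f x) (ball (f x) (e / K)) := nbhsx_ballx _ _ e1.
  move: nh nb; apply: filterS2 => y [_ h1]; rewrite -ball_normE /= => h2.
  apply: hA; rewrite -ball_normE /= distrC; apply: le_lt_trans h1 _.
  by rewrite mulrC -ltr_pdivlMr// distrC.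
have lo : h \o shift (f x) = cst (h (f x)) + l +o_ 0 id.
  apply/eqaddoP => e e0.
  have e1 : 0 < e / (k * K) by rewrite divr_gt0// mulr_gt0.
  have /eqaddoP /(_ _ e1) H1 := diff_locally df.
  have H2 : \forall z \near x,
      `|f z - f x - (z - x) *m J| <= e / (k * K) * `|z - x|.
    rewrite (near_shift 0 x); move: H1; apply: filterS => z /=.
    rewrite !fctE /= subr0 addrK /J /jacobian mul_rV_lin1.
    by rewrite opprD addrA.
  have H3 := ch _ H2; rewrite nbhs_simpl /= in H3.
  have : \forall w \near (0 : 'rV[R]_d),
    `|(h \o shift (f x) - (cst (h (f x)) + l)) w| <= e * `|w|; last by [].
  rewrite (near_shift (f x) 0).
  move: nh H3; apply: filterS2 => y [+ h1]; rewrite /= => -> h2.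
  rewrite !fctE /= hfx sub0r subrK.
  have -> : h y - (x + (y - f x) *m invmx J) = l (- (y - f x - (h y - x) *m J)).
    rewrite /l /=; move: (y - f x) => w.
    by rewrite mulNmx mulmxBl -mulmxA mulmxV// mulmx1 opprB opprD addrA.
  apply: le_trans (hk _) _; rewrite normrN.
  apply: le_trans (ler_wpM2l (ltW k0) (le_trans h2 (ler_wpM2l (ltW e1) h1))) _.
  have kK (n : R) : k * (e / (k * K) * (K * n)) = e * n.
    by field; rewrite !gt_eqF.
  by rewrite kK.
have d1 := diff_unique cl lo.
split; last exact: d1.
by apply/diff_locallyP; rewrite d1; split.
Qed.


Lemma unitmx_inj (F : fieldType) n (A : 'M[F]_n) :
  (forall u : 'rV_n, u *m A = 0 -> u = 0) -> A \in unitmx.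
Proof.
move=> h; rewrite -row_free_unit -kermx_eq0; apply/rowV0P => u /sub_kermxP.
exact: h.
Qed.

Lemma ball_segment V (x0 x y : V) (r t : R) : 0 <= t <= 1 ->
  ball x0 r x -> ball x0 r y -> ball x0 r (t *: (x - y) + y).
Proof.
move=> /andP[t0 t1]; rewrite -!ball_normE /= => bx by_.
have -> : x0 - (t *: (x - y) + y) = t *: (x0 - x) + (1 - t) *: (x0 - y).
  rewrite scalerBl scale1r addrCA -scalerBr.
  have -> : x0 - x - (x0 - y) = - (x - y).
    by rewrite opprB addrC addrA subrK opprB.
  by rewrite scalerN opprD addrA addrAC.
apply: le_lt_trans (ler_normD _ _) _.
rewrite !normrZ (ger0_norm t0) ger0_norm ?subr_ge0//.
have [->|t10] := eqVneq t 1; first by rewrite subrr mul0r addr0 mul1r.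
have t1' : 0 < 1 - t by rewrite subr_gt0 lt_neqAle t10.
have h1 : t * `|x0 - x| <= t * r by rewrite ler_wpM2l// ltW.
have h2 : (1 - t) * `|x0 - y| < (1 - t) * r by rewrite ltr_pM2l.
by apply: lt_le_trans (ler_ltD h1 h2) _; rewrite -mulrDl addrC subrK mul1r.
Qed.

(** The map [g x = f x - x] is 1/2-Lipschitz near [x0].  So [f] is injective
with a 2-Lipschitz inverse, and [f x = y] is solved by the fixed point of the
contraction [x |-> y - g x].  The differential of the inverse [h] at [y] is
the inverse matrix of the Jacobian at [h y]; thus, if [h] is of class C^k then
so is its derivative, whence smoothness by induction. *)
Lemma smooth_inverse_id d (f : 'rV[R]_d -> 'rV[R]_d) (U : set 'rV[R]_d) x0 :
  open U -> U x0 -> smooth_on U f -> (forall v, 'D_v f x0 = v) ->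
  exists r : R, exists h : 'rV[R]_d -> 'rV[R]_d, [/\ 0 < r, ball x0 r `<=` U,
    open (f @` ball x0 r), forall x, ball x0 r x -> h (f x) = x &
    smooth_on (f @` ball x0 r) h].
Proof.
move=> oU Ux0 sf Df0.
pose g x := f x + (-1) *: x.
have dfx x : U x -> differentiable f x.
  by move=> Ux; exact: (sf 1%N).1 x (mem_set Ux).
have dgx x : U x -> is_diff x g (fun v => 'd f x v + (-1) *: v).
  move=> /dfx/differentiableP d1.
  exact: (is_diffD d1 (is_diffZ (-1) (is_diff_id x))).
have kg : Ck_on 1 U g.
  apply: Ck_onD => //; apply: (@Ck_on_lin _ _ _ 1 U ( *:%R (-1))).
  exact: scaler_continuous.
have Dg0 v : 'D_v g x0 = 0.
  have [d1 d2] := dgx x0 Ux0.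
  rewrite deriveE// d2 -deriveE ?Df0; last exact: dfx.
  by rewrite scaleN1r subrr.
have half0 : 0 < (2^-1 : R) by rewrite invr_gt0.
have [r r0 [rU hr]] := small_diff oU Ux0 kg Dg0 half0.
have lip x y : ball x0 r x -> ball x0 r y -> `|g x - g y| <= 2^-1 * `|x - y|.
  move=> bx by_; apply: mean_value_ineq; first by rewrite mulr_ge0// ltW.
  move=> t t01; have bt := ball_segment t01 bx by_.
  by split; [have [] := dgx _ (rU _ bt)|exact: hr].
have fg x y : f x - f y = (g x - g y) + (x - y).
  rewrite /g !scaleN1r [- (f y - y)]opprB [y - f y]addrC.
  rewrite [f x - x + _]addrA -[RHS]addrA.
  by rewrite [y + _]addrCA subrr addr0 addrAC subrK.
have low x y : ball x0 r x -> ball x0 r y -> `|x - y| <= 2 * `|f x - f y|.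
  move=> bx by_; have h1 := lip _ _ bx by_.
  have : `|x - y| <= `|f x - f y| + `|g x - g y|.
    by rewrite -[x - y](addKr (g x - g y)) -fg addrC; exact: ler_normB.
  by lra.
(* The value [x0] is taken outside of the image of the ball only. *)
pose h y := xget x0 [set x | ball x0 r x /\ f x = y].
have hE x : ball x0 r x -> ball x0 r (h (f x)) /\ f (h (f x)) = f x.
  move=> bx; apply: (@xgetPex _ x0 [set z | ball x0 r z /\ f z = f x]).
  by exists x.
have hK x : ball x0 r x -> h (f x) = x.
  move=> bx; have [b1 e1] := hE x bx.
  apply/eqP; rewrite -subr_eq0 -normr_le0; apply: le_trans (low _ _ b1 bx) _.
  by rewrite e1 subrr normr0 mulr0.
have ofb : open (f @` ball x0 r).
  rewrite openE => _ [x1 bx1 <-].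
  have [e e0 he] : exists2 e : R, 0 < e & ball x1 e `<=` ball x0 r.
    have := @open_nbhs_nbhs _ x1 (ball x0 r) (conj (ball_open _ _) bx1).
    by move=> /nbhs_ballP[e e0 he]; exists e.
  (* Half the radius, so that the closed ball fits in the open one. *)
  pose s := e / 2.
  have s0 : 0 < s by rewrite divr_gt0.
  have sb x : `|x1 - x| <= s -> ball x0 r x.
    move=> xs; apply: he; rewrite -ball_normE /=; apply: le_lt_trans xs _.
    by rewrite /s ltr_pdivrMr// mulr_natr mulr2n ltrDl.
  apply/nbhs_ballP; exists (s / 2); first by rewrite /= divr_gt0.
  move=> y ys0; have ys : `|f x1 - y| < s / 2 by move: ys0; rewrite -ball_normE.
  pose A := closed_ball_ (fun x => `|x|) x1 s.
  pose T x := y - g x.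
  have TA : {homo T : x / A x >-> A x}.
    move=> x; rewrite /A /closed_ball_ /= => xs.
    have -> : x1 - T x = (f x1 - y) + (g x - g x1).
      have gx1 : g x1 = f x1 - x1 by rewrite /g scaleN1r.
      rewrite /T gx1 !opprB [RHS]addrCA [f x1 - y + _]addrC.
      by rewrite [x1 - f x1 + _]addrA subrK addrCA.
    apply: le_trans (ler_normD _ _) _.
    have := lip _ _ (sb _ xs) bx1; rewrite (distrC x x1); lra.
  pose F : {fun A >-> A} := HB.pack T (isFun.Build _ _ A A T TA).
  have cF : is_contraction F.
    exists (NngNum (ltW half0)); split; first by rewrite /=; lra.
    move=> [a b] [/= Aa Ab].
    have -> : T a - T b = - (g a - g b).
      by rewrite /T opprB addrC addrA subrK opprB.
    by rewrite normrN; apply: lip; exact: sb.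
  have [||p Ap pE] := banach_fixed_point cF.
  - exact: closed_closed_ball_.
  - by exists x1; rewrite /A /closed_ball_ /= subrr normr0 ltW.
  - exists p; first exact: sb.
    have : p + g p = y by rewrite [X in X + _]pE /= /T subrK.
    by rewrite /g scaleN1r addrCA subrr addr0.
have uJ x : ball x0 r x -> jacobian f x \in unitmx.
  move=> bx; apply: unitmx_inj => v; rewrite /jacobian mul_rV_lin1 => dv.
  have [_ d2] := dgx x (rU _ bx); have := hr x bx v.
  rewrite d2 /= dv add0r scaleN1r normrN => hv.
  by apply/eqP; rewrite -normr_le0; lra.
have dh y : (f @` ball x0 r) y ->
    is_diff y h (fun v => v *m invmx (jacobian f (h y))).
  move=> [x bx <-]; rewrite hK//; apply: (@is_diff_inverse _ _ _ _ 2).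
  - exact/dfx/rU.
  - exact: uJ.
  - exact: hK.
  have : \forall y \near f x, (f @` ball x0 r) y.
    by apply: open_nbhs_nbhs; split => //; exists x.
  apply: filterS => _ [z bz <-]; rewrite hK//; split=> //; exact: low.
exists r, h; split=> //.
elim=> [|k IH].
  by move=> y /set_mem/dh [d1 _]; exact: differentiable_continuous.
split=> [y /set_mem/dh [d1 _]//|v].
have : Ck_on k (f @` ball x0 r) ((fun x => v *m invmx (jacobian f x)) \o h).
  apply: (@Ck_on_comp _ _ _ _ k _ (ball x0 r)) => //.
  - exact: findim_mx.
  - exact: ball_open.
  - by move=> _ [x bx <-]; rewrite hK.
  apply: Ck_on_mulmx; first exact: ball_open.
  apply: Ck_on_invmx => //; first exact: ball_open.
  apply: Ck_on_mx; first exact: ball_open.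
  move=> i j; have [_ /(_ (delta_mx 0 i))] := sf k.+1.
  move=> /(Ck_onS rU) /(Ck_on_coord 0 j (ball_open _ _)).
  apply: Ck_on_eq; first exact: ball_open.
  move=> x /set_mem/rU/dfx d1; rewrite deriveE// /jacobian.
  by rewrite /lin1_mx mxE.
apply: Ck_on_eq => // y /set_mem/dh [d1 d2] /=.
by rewrite deriveE// d2.
Qed.

(** Composing with the inverse of the Jacobian at [x0] reduces to the case
where the latter is the identity. *)
Theorem smooth_inverse d (f : 'rV[R]_d -> 'rV[R]_d) (U : set 'rV[R]_d) x0 :
  open U -> U x0 -> smooth_on U f -> jacobian f x0 \in unitmx ->
  exists r : R, exists h : 'rV[R]_d -> 'rV[R]_d, [/\ 0 < r, ball x0 r `<=` U,
    open (f @` ball x0 r), forall x, ball x0 r x -> h (f x) = x &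
    smooth_on (f @` ball x0 r) h].
Proof.
move=> oU Ux0 sf uJ; set J := jacobian f x0 in uJ.
pose l : {linear 'rV[R]_d -> 'rV[R]_d} := mulmxr (invmx J).
have cl : continuous l by exact/lin_continuous/findim_mx.
have df0 : differentiable f x0 := (sf 1%N).1 x0 (mem_set Ux0).
have [|v|r [h [r0 rU o hK sh]]] := @smooth_inverse_id d (l \o f) U x0 oU Ux0.
- by move=> k; exact: Ck_on_lincomp.
- have dl : differentiable l (f x0) by exact: linear_differentiable.
  rewrite deriveE; last exact: differentiable_comp.
  rewrite (diff_comp df0 dl) -[LHS]/('d l (f x0) ('d f x0 v)).
  apply: etrans (congr1 (@^~ ('d f x0 v)) (diff_lin (f x0) cl)) _.
  have -> : 'd f x0 v = v *m J by rewrite /J /jacobian mul_rV_lin1.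
  exact: mulmxK.
have fE : f @` ball x0 r = l @^-1` ((l \o f) @` ball x0 r).
  apply/seteqP; split=> [_ [x bx <-]|y [x bx /= e]]; first by exists x.
  by exists x => //; apply: (can_inj (mulmxKV uJ)).
have of_ : open (f @` ball x0 r).
  by rewrite fE; apply: open_comp => // y _; exact: cl.
exists r, (h \o l); split=> // k.
apply: (@Ck_on_comp _ _ _ _ k _ ((l \o f) @` ball x0 r)) => //.
- exact: findim_mx.
- by rewrite fE.
- exact: Ck_on_lin.
Qed.

End IFT.

(** * Linear automorphisms of finite order *)

(** Write [P = C *m pid_mx k *m D] with [C] and [D] invertible.  The first [k]
rows of [D] span the image of [P] (acting on row vectors), the last [d - k]
rows of the inverse of [C] span its kernel, and [S] collects both. *)
Lemma idempotent_similar (F : fieldType) d (P : 'M[F]_d) : P *m P = P ->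
  exists k (S : 'M[F]_d),
    [/\ (k <= d)%N, S \in unitmx & S *m P = pid_mx k *m S].
Proof.
move=> PP; pose k := \rank P; pose C := col_ebase P; pose D := row_ebase P.
have PE : C *m pid_mx k *m D = P := mulmx_ebase P.
have kd : (k <= d)%N := rank_leq_row P.
have uC : C \in unitmx := col_ebase_unit P.
have uD : D \in unitmx := row_ebase_unit P.
have CP : invmx C *m P = pid_mx k *m D by rewrite -PE !mulmxA mulVmx// mul1mx.
pose S := pid_mx k *m D + copid_mx k *m invmx C.
have SP : S *m P = pid_mx k *m D.
  rewrite mulmxDl -CP -!mulmxA PP CP [copid_mx k *m _]mulmxA.
  by rewrite mul_copid_mx_pid// mul0mx addr0.
exists k, S; split=> //; last first.
  rewrite SP /S mulmxDr !mulmxA pid_mx_id// mul_pid_mx_copid//.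
  by rewrite mul0mx addr0.
apply: unitmx_inj => u uS.
have : u *m S *m P = 0 by rewrite uS mul0mx.
rewrite -mulmxA SP mulmxA => /(congr1 (mulmx^~ (invmx D))).
rewrite mulmxK// mul0mx => upid.
move: uS; rewrite mulmxDr !mulmxA upid mul0mx add0r => /(congr1 (mulmx^~ C)).
rewrite mulmxKV// mul0mx /copid_mx mulmxBr mulmx1 upid subr0.
exact.
Qed.

(** The mean [Q] of the powers of [A] is the projection on the kernel of the
map [A - 1] along its image, and [P = 1 - Q] is the complementary projection.
Here [U] and [V] are [Q] and [P] after the change of coordinates of
[idempotent_similar], in which the image of [P] is spanned by the first [k]
coordinate vectors. *)
Lemma finite_order_split (F : numFieldType) d n (A : 'M[F]_d) :
  (0 < n)%N -> A ^+ n = 1 ->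
  exists k (V U : 'M[F]_d), [/\ (k <= d)%N, V *m A + U - V \in unitmx,
    U *m (\sum_(j < n) A ^+ j) = n%:R *: U &
    forall x : 'rV[F]_d,
      x *m U = 0 <-> forall i : 'I_d, (k <= i)%N -> x ord0 i = 0].
Proof.
move=> n0 An; pose N := \sum_(j < n) A ^+ j.
have nn : n%:R != 0 :> F by rewrite pnatr_eq0 -lt0n.
have AN : A * N = N.
  rewrite /N mulr_sumr; case: n n0 An {N nn} => // n _ An.
  rewrite big_ord_recr big_ord_recl /= -exprS An expr0 addrC; congr (_ + _).
  by apply: eq_bigr => i _; rewrite -exprS.
have NA : N * A = N.
  rewrite -[RHS]AN /N mulr_suml mulr_sumr; apply: eq_bigr => i _.
  by rewrite -exprS exprSr.
have vN (v : 'M[F]_d) : v * A = v -> v * N = n%:R *: v.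
  move=> vA; have vAj j : v * A ^+ j = v.
    by elim: j => [|j IH]; rewrite ?mulr1// exprS mulrA vA.
  rewrite /N mulr_sumr (eq_bigr (fun=> v)) => [|j _]; last exact: vAj.
  by rewrite sumr_const card_ord scaler_nat.
have vN' (v : 'rV[F]_d) : v *m A = v -> v *m N = n%:R *: v.
  move=> vA; have vAj j : v *m A ^+ j = v.
    by elim: j => [|j IH]; rewrite ?mulmx1// exprS mulmxA vA.
  rewrite /N mulmx_sumr (eq_bigr (fun=> v)) => [|j _]; last exact: vAj.
  by rewrite sumr_const card_ord scaler_nat.
pose Q := n%:R^-1 *: N; pose P : 'M[F]_d := 1%:M - Q.
have QA : Q *m A = Q by rewrite /Q -scalemxAl -[N *m A]/(N * A) NA.
have AQ : A *m Q = Q by rewrite /Q -scalemxAr -[A *m N]/(A * N) AN.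
have QQ : Q *m Q = Q.
  by rewrite {2}/Q -scalemxAr -[Q *m N]/(Q * N) vN// scalerA mulVf// scale1r.
have PQ : P *m Q = 0 by rewrite mulmxBl mul1mx QQ subrr.
have PP : P *m P = P by rewrite {2}/P mulmxBr mulmx1 PQ subr0.
have [k [S [kd uS SP]]] := idempotent_similar PP.
have PD : P + Q = 1%:M by rewrite subrK.
clearbody P.
exists k, (S *m P), (S *m Q); split=> //.
- apply: unitmx_inj => x.
  have -> : S *m P *m A + S *m Q - S *m P = S *m (P *m A + Q - P).
    by rewrite mulmxBr mulmxDr mulmxA.
  rewrite mulmxA; set w := x *m S => wT.
  have wQ : w *m Q = 0.
    have TQ : (P *m A + Q - P) *m Q = Q.
      by rewrite mulmxBl mulmxDl -mulmxA AQ QQ PQ add0r subr0.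
    by rewrite -TQ mulmxA wT mul0mx.
  have wPA : w *m P *m A = w *m P.
    have : w *m P *m A - w *m P + w *m Q = 0.
      by rewrite -wT mulmxBr mulmxDr mulmxA addrAC.
    by rewrite wQ addr0 => /eqP; rewrite subr_eq0 => /eqP.
  have wP : w *m P = 0.
    have := vN' _ wPA.
    have -> : N = n%:R *: Q by rewrite scalerA divff// scale1r.
    rewrite -scalemxAr -mulmxA PQ mulmx0 scaler0 => /esym/eqP.
    by rewrite scaler_eq0 (negPf nn) => /eqP.
  have w0 : w = 0 by rewrite -[w]mulmx1 -PD mulmxDr wP wQ addr0.
  by rewrite -[x](mulmxK uS) -/w w0 mul0mx.
- by rewrite -mulmxA -[Q *m _]/(Q * N) vN// -scalemxAr.
move=> x.
have -> : x *m (S *m Q) = (x - x *m pid_mx k) *m S.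
  have -> : Q = 1%:M - P by rewrite -PD addrC addKr.
  by rewrite mulmxBr mulmx1 mulmxBr SP mulmxBl !mulmxA.
have pidE i : (x *m pid_mx k) ord0 i = x ord0 i *+ (i < k)%N.
  rewrite mxE (bigD1 i)//= big1 ?addr0 => [|j ji].
    by rewrite mxE eqxx /= mulr_natr.
  by move: ji; rewrite mxE -val_eqE => /negPf /= ->; rewrite mulr0.
split=> [/(congr1 (mulmx^~ (invmx S)))|x0].
  rewrite mulmxK// mul0mx => /eqP; rewrite subr_eq0 => /eqP/rowP e i ki.
  by rewrite e pidE ltnNge ki.
suff -> : x - x *m pid_mx k = 0 by rewrite mul0mx.
apply/rowP => i; have := pidE i; rewrite !mxE => ->.
by case: ltnP => [_|/x0 ->]; rewrite ?subrr// mul0rn subrr.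
Qed.

(** * Smooth maps into a Lie group *)

Section ChartLemmas.
Context {R : realType} {T : topologicalType} {E : normedModType R}.
Implicit Types phi : chart T E.

Lemma chart_invK phi x : chart_cod phi x -> phi (chart_inv phi x) = x.
Proof. by move=> [y dy <-]; rewrite chartK//; exact: mem_set. Qed.

Lemma chart_inv_dom phi x : chart_cod phi x -> chart_dom phi (chart_inv phi x).
Proof. by move=> [y dy <-]; rewrite chartK//; exact: mem_set. Qed.

Lemma chart_domK phi y : chart_dom phi y -> chart_inv phi (phi y) = y.
Proof. by move=> dy; rewrite chartK//; exact: mem_set. Qed.

Lemma chart_codP phi y : chart_dom phi y -> chart_cod phi (phi y).
Proof. by exists y. Qed.

Lemma open_chart_cod phi : open (chart_cod phi).
Proof. exact: chart_cod_open. Qed.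

(** Read from right to left, this presents a set in a chart as a preimage, so
that membership is tested by applying [chart_inv]. *)
Lemma chart_image_cap phi (S : set T) :
  phi @` (chart_dom phi `&` S) = chart_cod phi `&` (chart_inv phi @^-1` S).
Proof.
apply/seteqP; split=> [_ [y [dy Sy] <-]|x [[y dy <-]] /=].
  by split; [exists y|rewrite /= chart_domK].
by rewrite chart_domK// => Sy; exists y.
Qed.

End ChartLemmas.

Lemma open_preimI (X Y : topologicalType) (U : set X) (f : X -> Y) (O : set Y) :
  open U -> {in U, continuous f} -> open O -> open (U `&` f @^-1` O).
Proof.
move=> oU cf oO; rewrite openE => x [Ux Ofx].
apply: filterI; first exact: open_nbhs_nbhs.
by apply: cf; [exact: mem_set|exact: open_nbhs_nbhs].
Qed.

Lemma continuous_inS (X Y : topologicalType) (U U' : set X) (f : X -> Y) :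
  U' `<=` U -> {in U, continuous f} -> {in U', continuous f}.
Proof. by move=> UU cf x /set_mem /UU /mem_set /cf. Qed.

Section SmoothG.
Context {R : realType} {d : nat} {G : lieGroupType R d}.
Local Notation E := ('rV[R]_d).
Local Notation atlasG := (@atlas R d G).
Implicit Types V W : normedModType R.

Lemma chart_at (g : G) : exists2 phi, atlasG phi & chart_dom phi g.
Proof.
have : [set: G] g by [].
by rewrite -(@atlas_cover R d G) => -[phi]; exists phi.
Qed.

(** Smoothness of a map from an open subset of a normed space to the group,
tested only against the charts of the given atlas of the target. *)
Definition smoothG V (U : set V) (F : V -> G) :=
  {in U, continuous F} /\
  forall psi, atlasG psi -> smooth_on (U `&` F @^-1` chart_dom psi) (psi \o F).

Lemma smoothG_open V (U : set V) F (O : set G) :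
  open U -> smoothG U F -> open O ->
  open (U `&` F @^-1` O).
Proof. by move=> oU [cF _]; exact: open_preimI. Qed.

Lemma smoothG_cst V (U : set V) g : smoothG U (fun=> g).
Proof.
split=> [x _|psi _ k]; [exact: cvg_cst|exact: Ck_on_cst].
Qed.

Lemma smoothG_chart phi : atlasG phi -> smoothG (chart_cod phi) (chart_inv phi).
Proof.
move=> Aphi; split=> [|psi Apsi]; first exact: chart_inv_continuous.
have [] := @atlas_compatible R d G _ _ Aphi Apsi.
by rewrite chart_image_cap.
Qed.

Lemma smoothG_comp V W (U : set V) (U' : set W) (f : V -> W) (F : W -> G) :
  findim W -> open U -> open U' -> (forall x, U x -> U' (f x)) ->
  smooth_on U f -> smoothG U' F -> smoothG U (F \o f).
Proof.
move=> fW oU oU' UU' sf sF; have [cF hF] := sF.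
have cf : {in U, continuous f} := sf 0%N.
split=> [x xU|psi Apsi k].
  apply: continuous_comp; [exact: cf|exact/cF/mem_set/UU'/set_mem].
apply: (@Ck_on_comp _ _ _ _ k _ (U' `&` F @^-1` chart_dom psi)
  (psi \o F) f) => //.
- apply: open_preimI => //; last exact: chart_dom_open.
  move=> x xU; apply: continuous_comp; [exact: cf|exact/cF/mem_set/UU'/set_mem].
- by apply: smoothG_open => //; exact: chart_dom_open.
- by move=> x [/UU' ? ?]; split.
- by apply: Ck_onS (sf k) => x [].
- exact: hF.
Qed.

Lemma continuousG_mul (X : topologicalType) (F H : X -> G) x :
  {for x, continuous F} -> {for x, continuous H} ->
  {for x, continuous (fun y => (F y * H y)%g)}.
Proof.
move=> cF cH; have [cm _] := @mulg_smooth R d G.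
have cFH : {for x, continuous (fun y => (F y, H y))} by exact: cvg_pair.
exact: (@continuous_comp _ _ _ _ (fun z : G * G => (z.1 * z.2)%g) x cFH (cm _)).
Qed.

Lemma continuousG_inv (X : topologicalType) (F : X -> G) x :
  {for x, continuous F} -> {for x, continuous (fun y => (F y)^-1%g)}.
Proof.
move=> cF; have [ci _] := @invg_smooth R d G.
exact: (@continuous_comp _ _ _ F (fun z : G => z^-1%g) x cF (ci _)).
Qed.

Definition mul_chart (phi1 phi2 psi : chart G E) : E * E -> E :=
  fun z => psi (chart_inv phi1 z.1 * chart_inv phi2 z.2)%g.

Definition mul_dom (phi1 phi2 psi : chart G E) : set (E * E) :=
  [set z | [/\ chart_cod phi1 z.1, chart_cod phi2 z.2 &
    chart_dom psi (chart_inv phi1 z.1 * chart_inv phi2 z.2)%g]].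

(** Connects the local expression of the multiplication with the form in which
the smoothness of the multiplication is postulated. *)
Lemma mul_domE phi1 phi2 psi : mul_dom phi1 phi2 psi =
  chart_cod (prod_chart phi1 phi2) `&`
  [set z | chart_dom psi ((chart_inv (prod_chart phi1 phi2) z).1 *
                          (chart_inv (prod_chart phi1 phi2) z).2)%g].
Proof.
apply/seteqP; split=> [[z1 z2] [/= c1 c2 h]|z [[[y1 y2] [/= d1 d2] <-] h]].
  split=> //; case: c1 => y1 d1 <-; case: c2 => y2 d2 <-; by exists (y1, y2).
by split=> //=; [exists y1|exists y2].
Qed.

Lemma mul_dom_open phi1 phi2 psi : open (mul_dom phi1 phi2 psi).
Proof.
have [cm _] := @mulg_smooth R d G.
rewrite mul_domE; apply: (@open_preimI _ _ _
  (fun z => ((chart_inv (prod_chart phi1 phi2) z).1 *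
             (chart_inv (prod_chart phi1 phi2) z).2)%g)).
- exact: open_chart_cod.
- move=> z zU; apply: (@continuous_comp _ _ _ (chart_inv (prod_chart phi1 phi2))
    (fun z : G * G => (z.1 * z.2)%g)).
    exact: chart_inv_continuous.
  exact: cm.
- exact: chart_dom_open.
Qed.

Lemma mul_chart_smooth phi1 phi2 psi :
  atlasG phi1 -> atlasG phi2 -> atlasG psi ->
  smooth_on (mul_dom phi1 phi2 psi) (mul_chart phi1 phi2 psi).
Proof.
move=> A1 A2 A3; have [_ /(_ (prod_chart phi1 phi2) psi)] := @mulg_smooth R d G.
rewrite mul_domE; apply => //.
by exists phi1 => //; exists phi2.
Qed.

(** Near each point the product is the composition of the local expression of
the multiplication with the pair of local expressions of [F] and [H]. *)
Lemma smoothG_mul V (U : set V) (F H : V -> G) : open U ->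
  smoothG U F -> smoothG U H -> smoothG U (fun x => F x * H x)%g.
Proof.
move=> oU sF sH; have [cF hF] := sF; have [cH hH] := sH.
have cFH : {in U, continuous (fun x => F x * H x)%g}.
  by move=> x xU; apply: continuousG_mul; [exact: cF|exact: cH].
split=> // psi Apsi k; apply: Ck_on_local => x [Ux dx].
have [phi1 A1 d1] := chart_at (F x); have [phi2 A2 d2] := chart_at (H x).
pose U' := U `&` F @^-1` chart_dom phi1 `&` H @^-1` chart_dom phi2 `&`
  (fun x => F x * H x)%g @^-1` chart_dom psi.
have oU1 : open (U `&` F @^-1` chart_dom phi1).
  by apply: smoothG_open => //; exact: chart_dom_open.
have oU2 : open (U `&` F @^-1` chart_dom phi1 `&` H @^-1` chart_dom phi2).
  apply: open_preimI => //; last exact: chart_dom_open.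
  by apply: continuous_inS cH => y [].
have oU' : open U'.
  apply: open_preimI => //; last exact: chart_dom_open.
  by apply: continuous_inS cFH => y [[]].
exists U' => //.
have : Ck_on k U' (mul_chart phi1 phi2 psi \o
                   (fun y => (phi1 (F y), phi2 (H y)))).
  apply: (@Ck_on_comp _ _ _ _ k _ (mul_dom phi1 phi2 psi)) => //.
  - by apply: findim_prod; exact: findim_mx.
  - exact: mul_dom_open.
  - move=> y [[[Uy y1] y2] y3]; split=> /=; try exact: chart_codP.
    by rewrite !chart_domK.
  - apply: Ck_on_pair => //.
      by apply: Ck_onS (hF phi1 A1 k) => y [[[]]].
    by apply: Ck_onS (hH phi2 A2 k) => y [[[]]].
  - exact: mul_chart_smooth.
apply: Ck_on_eq => // y /set_mem[[[Uy y1] y2] y3].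
by rewrite /mul_chart /= !chart_domK.
Qed.

Definition inv_chart (phi psi : chart G E) : E -> E :=
  fun z => psi ((chart_inv phi z)^-1)%g.

Definition inv_dom (phi psi : chart G E) : set E :=
  chart_cod phi `&` [set z | chart_dom psi ((chart_inv phi z)^-1)%g].

Lemma inv_dom_open phi psi : open (inv_dom phi psi).
Proof.
apply: (@open_preimI _ _ _ (fun z => ((chart_inv phi z)^-1)%g)).
- exact: open_chart_cod.
- by move=> z zU; apply: continuousG_inv; exact: chart_inv_continuous.
- exact: chart_dom_open.
Qed.

Lemma inv_chart_smooth phi psi : atlasG phi -> atlasG psi ->
  smooth_on (inv_dom phi psi) (inv_chart phi psi).
Proof.
by move=> A1 A2; have [_ /(_ phi psi A1 A2)] := @invg_smooth R d G.
Qed.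

Lemma smoothG_inv V (U : set V) (F : V -> G) : open U ->
  smoothG U F -> smoothG U (fun x => (F x)^-1)%g.
Proof.
move=> oU sF; have [cF hF] := sF.
have cFi : {in U, continuous (fun x => (F x)^-1)%g}.
  by move=> x xU; apply: continuousG_inv; exact: cF.
split=> // psi Apsi k; apply: Ck_on_local => x [Ux dx].
have [phi A1 d1] := chart_at (F x).
pose U' := U `&` F @^-1` chart_dom phi `&`
  (fun x => (F x)^-1)%g @^-1` chart_dom psi.
have oU1 : open (U `&` F @^-1` chart_dom phi).
  by apply: smoothG_open => //; exact: chart_dom_open.
have oU' : open U'.
  apply: open_preimI => //; last exact: chart_dom_open.
  by apply: continuous_inS cFi => y [].
exists U' => //.
have : Ck_on k U' (inv_chart phi psi \o (phi \o F)).
  apply: (@Ck_on_comp _ _ _ _ k _ (inv_dom phi psi)) => //.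
  - exact: findim_mx.
  - exact: inv_dom_open.
  - move=> y [[Uy y1] y2]; split=> /=; first exact: chart_codP.
    by rewrite chart_domK.
  - by apply: Ck_onS (hF phi A1 k) => y [[]].
  - exact: inv_chart_smooth.
apply: Ck_on_eq => // y /set_mem[[Uy y1] y2].
by rewrite /inv_chart /= chart_domK.
Qed.

Lemma smoothG_conj V (U : set V) (F : V -> G) g : open U ->
  smoothG U F -> smoothG U (fun x => F x ^ g)%g.
Proof.
move=> oU sF.
apply: (@smoothG_mul V U (fun=> g^-1%g) (fun x => (F x * g)%g)) => //.
  exact: smoothG_cst.
by apply: smoothG_mul => //; exact: smoothG_cst.
Qed.

Lemma smoothG_differentiable V (U : set V) (F : V -> G) phi x : smoothG U F ->
  U x -> atlasG phi -> chart_dom phi (F x) -> differentiable (phi \o F) x.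
Proof. by move=> [_ hF] Ux /hF/(_ 1%N) [h _] dx; apply: h; exact: mem_set. Qed.

End SmoothG.

(** * Differentials at the identity *)

Lemma near_eq_is_diff (R : realType) (V W : normedModType R)
    (f g df : V -> W) (a : V) :
  (\near a, f a = g a) -> is_diff a f df -> is_diff a g df.
Proof.
move=> fg [d1 d2]; have dg := near_eq_differentiable fg d1.
split=> //; rewrite -d2; apply/funext => v.
by rewrite -!deriveE//; apply/esym; exact: near_eq_derive.
Qed.

Section Tangent.
Context {R : realType} {d : nat} {G : lieGroupType R d}.
Local Notation E := ('rV[R]_d).
Local Notation atlasG := (@atlas R d G).
Variables (phi : chart G E) (Aphi : atlasG phi) (phi1 : chart_dom phi 1%g).
Let p := phi 1%g.

Let cp : chart_cod phi p. Proof. exact: chart_codP. Qed.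
Let pK : chart_inv phi p = 1%g. Proof. exact: chart_domK. Qed.

Definition shifted_chart_inv (x : E) : G := chart_inv phi (x + phi 1%g).
Local Notation t := shifted_chart_inv.

(** The matrix [M] of the differential at 0, in the chart [phi] and acting on
row vectors, of a map that sends 0 to the identity. *)
Definition tangent (F : E -> G) (M : 'M[R]_d) : Prop :=
  [/\ F 0 = 1%g, {for 0, continuous F} &
      is_diff (0 : E) (phi \o F) (fun v => v *m M)].

Lemma near_chart_dom (F : E -> G) : F 0 = 1%g -> {for 0, continuous F} ->
  \forall x \near (0 : E), chart_dom phi (F x).
Proof.
move=> F0 cF; apply: cF; rewrite F0; apply: open_nbhs_nbhs; split=> //.
exact: chart_dom_open.
Qed.

Lemma is_diff_mx (f : E -> E) x : differentiable f x ->
  exists M : 'M[R]_d, is_diff x f (fun v => v *m M).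
Proof.
move=> df; exists (jacobian f x); split=> //.
by apply/funext => v; rewrite /jacobian mul_rV_lin1.
Qed.

Lemma tangent_uniq F M N : tangent F M -> tangent F N -> M = N.
Proof.
move=> [_ _ [_ h1]] [_ _ [_ h2]]; apply/row_matrixP => i.
by rewrite !rowE; move: h1; rewrite h2 => /(congr1 (@^~ (delta_mx 0 i))).
Qed.

Lemma tangent_eq F H M : F =1 H -> tangent F M -> tangent H M.
Proof. by move=> /funext ->. Qed.

Lemma tangent_cst : tangent (fun=> 1%g) 0.
Proof.
split=> [||]; [by []|move=> A nA; exact: (@cvg_cst G 1%g E (nbhs (0 : E)))|].
have -> : (fun v : E => v *m (0 : 'M[R]_d)) = 0.
  by apply/funext => v; rewrite mulmx0.
exact: is_diff_cst.
Qed.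

(** In the chart [phi], the recentred inverse chart is the translation [x |->
x + phi 1]. *)
Lemma tangent_shifted : tangent t 1%:M.
Proof.
have oc : open (chart_cod phi) by exact: open_chart_cod.
have near_cod : \forall x \near (0 : E), chart_cod phi (x + p).
  have : \forall x \near p, chart_cod phi x by exact: open_nbhs_nbhs.
  by rewrite (near_shift 0 p); apply: filterS => x /=; rewrite subr0.
have dsh := is_diffD (is_diff_id (0 : E)) (is_diff_cst p (0 : E)).
split; first by rewrite /t add0r.
  apply: (@continuous_comp _ _ _ (fun x : E => x + p) (chart_inv phi)).
    by have [d1 _] := dsh; exact: (differentiable_continuous d1).
  by apply: chart_inv_continuous; rewrite add0r; exact: mem_set.
move: dsh; have -> : (id + 0 : E -> E) = (fun v => v *m 1%:M).
  by apply/funext => v; rewrite mulmx1 -[LHS]/(v + 0) addr0.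
apply: near_eq_is_diff; apply: filterS near_cod => x cx /=.
by rewrite chart_invK.
Qed.

Lemma tangent_mulmx F M B :
  tangent F M -> tangent (fun x => F (x *m B)) (B *m M).
Proof.
move=> [F0 cF dF]; have l0 : (0 : E) *m B = 0 by rewrite mul0mx.
have cl : continuous (mulmxr B : E -> E) by exact/lin_continuous/findim_mx.
split; first by rewrite l0.
  apply: (@continuous_comp _ _ _ (mulmxr B : E -> E) F); first exact: cl.
  by rewrite /= l0.
have dl : is_diff (0 : E) (mulmxr B : E -> E) (mulmxr B : E -> E).
  by split; [exact: linear_differentiable|rewrite diff_lin].
have dF' : is_diff ((mulmxr B : E -> E) 0) (phi \o F) (fun v => v *m M).
  by rewrite /= l0.
have := is_diff_comp dl dF'.
suff -> : (fun v : E => v *m M) \o (mulmxr B : E -> E) =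
  fun v => v *m (B *m M) by [].
by apply/funext => v /=; rewrite mulmxA.
Qed.

Let mul_dom_pp : mul_dom phi phi phi (p, p).
Proof. by split; [exact: cp|exact: cp|rewrite /= !pK mulg1]. Qed.

(** By linearity it is enough to vary one factor at a time, and then the other
one is the identity. *)
Let mul_chart_is_diff :
  is_diff (p, p) (mul_chart phi phi phi) (fun v : E * E => v.1 + v.2).
Proof.
have dm : differentiable (mul_chart phi phi phi) (p, p).
  exact: (mul_chart_smooth Aphi Aphi Aphi 1%N).1 _ (mem_set mul_dom_pp).
have near_cod : \forall x \near p, chart_cod phi x.
  by apply: open_nbhs_nbhs; split=> //; exact: open_chart_cod.
split=> //; apply/funext => -[a b] /=.
have -> : (a, b) = (a, 0) + (0, b) :> E * E.
  by rewrite -[RHS]/(_, _) addr0 add0r.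
rewrite linearD; congr (_ + _).
- have di : is_diff p (fun x : E => (x, p)) (fun v => (v, 0)).
    exact: (is_diff_pair (is_diff_id p) (is_diff_cst p p)).
  have [_] := is_diff_comp di (differentiableP dm).
  have [_ ->] : is_diff p (mul_chart phi phi phi \o (fun x : E => (x, p))) id.
    apply: near_eq_is_diff (is_diff_id p); apply: filterS near_cod => x cx.
    by rewrite /mul_chart /= pK mulg1 chart_invK.
  by move=> /(congr1 (@^~ a)).
- have di : is_diff p (fun x : E => (p, x)) (fun v => (0, v)).
    exact: (is_diff_pair (is_diff_cst p p) (is_diff_id p)).
  have [_] := is_diff_comp di (differentiableP dm).
  have [_ ->] : is_diff p (mul_chart phi phi phi \o (fun x : E => (p, x))) id.
    apply: near_eq_is_diff (is_diff_id p); apply: filterS near_cod => x cx.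
    by rewrite /mul_chart /= pK mul1g chart_invK.
  by move=> /(congr1 (@^~ b)).
Qed.

Lemma tangent_mul F H M N : tangent F M -> tangent H N ->
  tangent (fun x => F x * H x)%g (M + N).
Proof.
move=> [F0 cF dF] [H0 cH dH]; split; first by rewrite F0 H0 mulg1.
  exact: continuousG_mul.
have dm : is_diff ((fun x => ((phi \o F) x, (phi \o H) x)) 0)
    (mul_chart phi phi phi) (fun v : E * E => v.1 + v.2).
  by rewrite /= F0 H0; exact: mul_chart_is_diff.
have := is_diff_comp (is_diff_pair dF dH) dm.
have -> : (fun v : E * E => v.1 + v.2) \o (fun y : E => (y *m M, y *m N)) =
    (fun v => v *m (M + N)).
  by apply/funext => v /=; rewrite mulmxDr.
apply: near_eq_is_diff.
apply: filterS2 (near_chart_dom F0 cF) (near_chart_dom H0 cH) => x dx dy.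
by rewrite /mul_chart /= !chart_domK.
Qed.

(** The inverse map is differentiable, and its differential is then dictated
by [F x * (F x)^-1 = 1] and [tangent_mul]. *)
Lemma tangent_inv F M : tangent F M -> tangent (fun x => (F x)^-1)%g (- M).
Proof.
move=> tF; have [F0 cF dF] := tF.
have di : differentiable (inv_chart phi phi) p.
  apply: (inv_chart_smooth Aphi Aphi 1%N).1; apply: mem_set; split=> //=.
  by rewrite pK invg1.
have : differentiable (phi \o (fun x => (F x)^-1)%g) 0.
  have di' : differentiable (inv_chart phi phi) ((phi \o F) 0) by rewrite /= F0.
  have [d1 _] := dF.
  apply: near_eq_differentiable (differentiable_comp d1 di').
  apply: filterS (near_chart_dom F0 cF) => x dx.
  by rewrite /inv_chart /= chart_domK.
move=> /is_diff_mx[N dN].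
have tN : tangent (fun x => (F x)^-1)%g N.
  by split=> //; [rewrite F0 invg1|exact: continuousG_inv].
have := tangent_mul tF tN.
move=> /(@tangent_eq _ (fun=> 1%g)) => /(_ (fun x => mulgV _)) /tangent_uniq.
by move=> /(_ _ tangent_cst)/eqP; rewrite addrC addr_eq0 => /eqP <-.
Qed.

Definition conj_chart (g : G) : E -> E := fun x => phi (chart_inv phi x ^ g)%g.

(** As [y ^ g] is [g^-1 * y * g], this is the matrix of the adjoint
representation at [g^-1]. *)
Definition adjoint_mx (g : G) : 'M[R]_d := jacobian (conj_chart g) p.

Lemma tangent_conj F M g : tangent F M ->
  tangent (fun x => F x ^ g)%g (M *m adjoint_mx g).
Proof.
move=> [F0 cF dF].
have cc (h : G) : {for (0 : E), continuous (fun=> h)}.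
  by move=> A nA; exact: (@cvg_cst G h E (nbhs (0 : E))).
have cFg : {for 0, continuous (fun x => F x ^ g)%g}.
  apply: (@continuousG_mul _ _ _ _ (fun=> g^-1%g) (fun x => (F x * g)%g)) => //.
  exact: continuousG_mul.
split=> //; first by rewrite F0 conj1g.
have oc : open (chart_cod phi) by exact: open_chart_cod.
have dc : differentiable (conj_chart g) p.
  apply: (@smoothG_differentiable _ _ _ _ (chart_cod phi)
    (fun x => chart_inv phi x ^ g)%g) => //.
    exact/smoothG_conj/smoothG_chart.
  by rewrite pK conj1g.
have dc' : is_diff ((phi \o F) 0) (conj_chart g) (fun v => v *m adjoint_mx g).
  rewrite /= F0; split=> //.
  by apply/funext => v; rewrite /adjoint_mx /jacobian mul_rV_lin1.
have := is_diff_comp dF dc'.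
have -> : (fun v => v *m adjoint_mx g) \o (fun v : E => v *m M) =
    fun v => v *m (M *m adjoint_mx g).
  by apply/funext => v /=; rewrite mulmxA.
apply: near_eq_is_diff; apply: filterS (near_chart_dom F0 cF) => x dx.
by rewrite /conj_chart /= chart_domK.
Qed.

Lemma tangent_conjX F M g j : tangent F M ->
  tangent (fun x => F x ^ (g ^+ j))%g (M *m adjoint_mx g ^+ j).
Proof.
move=> tF; elim: j => [|j IH].
  by rewrite expr0 mulmx1; apply: tangent_eq tF => x; rewrite conjg1.
rewrite exprSr mulmxA; apply: tangent_eq (tangent_conj g IH) => x.
by rewrite -conjgM -expgSr.
Qed.

Lemma adjoint_mx_finite_order g n : (g ^+ n)%g = 1%g -> adjoint_mx g ^+ n = 1.
Proof.
move=> gn; have := tangent_conjX g n tangent_shifted.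
rewrite mul1mx gn => /tangent_uniq; apply.
by apply: tangent_eq tangent_shifted => x; rewrite conjg1.
Qed.

(** The product of the conjugates of [y] by [g ^ (n - 1)], ..., [g], [1], in
this order: the factor by which [(g * y) ^ n] differs from [g ^ n]. *)
Fixpoint twisted_power (g : G) (n : nat) (y : G) : G :=
  if n is n'.+1 then (y ^ (g ^+ n') * twisted_power g n' y)%g else 1%g.

Lemma twisted_powerE g n y : ((g * y) ^+ n = g ^+ n * twisted_power g n y)%g.
Proof.
elim: n => [|n IH] /=; first by rewrite !expg0 mulg1.
by rewrite expgS IH expgS mulgA -(mulgA g y) (conjgC y) !mulgA.
Qed.

Lemma tangent_twisted_power F M g n : tangent F M ->
  tangent (fun x => twisted_power g n (F x))
          (M *m \sum_(j < n) adjoint_mx g ^+ j).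
Proof.
move=> tF; elim: n => [|n IH] /=.
  by rewrite big_ord0 mulmx0; exact: tangent_cst.
rewrite big_ord_recr /= addrC mulmxDr.
by apply: tangent_mul => //; exact: tangent_conjX.
Qed.

End Tangent.

(** * Charts obtained from local diffeomorphisms *)

(** The chart [phi] is precomposed with the diffeomorphism [y |-> a * y * b]
of the group and postcomposed with a diffeomorphism [h], inverse to [f], from
an open part of the codomain of [phi] to [W]. *)
Section TranslatedChart.
Context {R : realType} {d : nat} {G : lieGroupType R d}.
Local Notation E := ('rV[R]_d).
Local Notation atlasG := (@atlas R d G).
Variables (phi : chart G E) (Aphi : atlasG phi).
Variables (W : set E) (f h : E -> E) (a b : G).
Hypotheses (oW : open W) (ofW : open (f @` W)) (fW : f @` W `<=` chart_cod phi).
Hypotheses (fK : forall x, W x -> h (f x) = x).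
Hypotheses (sf : smooth_on W f) (sh : smooth_on (f @` W) h).

Let m (y : G) : G := (a * y * b)%g.
Let dom : set G := [set y | chart_dom phi (m y) /\ (f @` W) (phi (m y))].
Let fn (y : G) : E := h (phi (m y)).
Let inv (x : E) : G := (a^-1 * chart_inv phi (f x) * b^-1)%g.

Let cm : continuous m.
Proof.
move=> y; have cc (c : G) : {for y, continuous (fun=> c)}.
  by move=> A nA; exact: (@cvg_cst G c G (nbhs y)).
apply: continuousG_mul => //; apply: continuousG_mul => //.
Qed.

Let invKm x : m (inv x) = chart_inv phi (f x).
Proof. by rewrite /m /inv !mulgA mulgV mul1g mulgVK. Qed.

Let mK y : (a^-1 * m y * b^-1)%g = y.
Proof. by rewrite /m !mulgA mulVg mul1g mulgK. Qed.

Let inv_dom x : W x -> dom (inv x).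
Proof.
move=> Wx; have cfx : chart_cod phi (f x) by apply: fW; exists x.
split; rewrite invKm; first exact: chart_inv_dom.
by rewrite chart_invK//; exists x.
Qed.

Let invK x : W x -> fn (inv x) = x.
Proof.
move=> Wx; have cfx : chart_cod phi (f x) by apply: fW; exists x.
by rewrite /fn invKm chart_invK// fK.
Qed.

Let fn_dom : fn @` dom = W.
Proof.
apply/seteqP; split=> [_ [y [dy [x Wx e]] <-]|x Wx].
  by rewrite /fn -e fK.
by exists (inv x); [exact: inv_dom|exact: invK].
Qed.

Let dom_open : open dom.
Proof.
have : open (m @^-1` (chart_dom phi `&` phi @^-1` (f @` W))).
  apply: open_comp => //; apply: open_preimI => //; first exact: chart_dom_open.
  exact: chart_continuous.
exact.
Qed.

Let cod_open : open (fn @` dom). Proof. by rewrite fn_dom. Qed.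

Let fnK : {in dom, cancel fn inv}.
Proof.
move=> y /set_mem[dy [x Wx e]]; rewrite /inv /fn -e fK// e.
by rewrite (chart_domK dy); exact: mK.
Qed.

Let fn_continuous : {in dom, continuous fn}.
Proof.
move=> y /set_mem[dy oy]; apply: (@continuous_comp _ _ _ (phi \o m) h).
  apply: continuous_comp; first exact: cm.
  exact/chart_continuous/mem_set.
exact/(sh 0%N)/mem_set.
Qed.

Let sinv : smoothG W inv.
Proof.
have s1 : smoothG W (chart_inv phi \o f).
  apply: (@smoothG_comp _ _ _ _ _ W (chart_cod phi)) => //.
  - exact: findim_mx.
  - exact: open_chart_cod.
  - by move=> x Wx; apply: fW; exists x.
  - exact: smoothG_chart.
apply: smoothG_mul => //; last exact: smoothG_cst.
by apply: smoothG_mul => //; exact: smoothG_cst.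
Qed.

Let inv_continuous : {in fn @` dom, continuous inv}.
Proof. by rewrite fn_dom; exact: sinv.1. Qed.

Definition translated_chart : chart G E :=
  Chart dom_open cod_open fnK fn_continuous inv_continuous.

Lemma translated_chart_cod : chart_cod translated_chart = W.
Proof. exact: fn_dom. Qed.

Lemma translated_chart_invE x :
  chart_inv translated_chart x = (a^-1 * chart_inv phi (f x) * b^-1)%g.
Proof. by []. Qed.

Lemma translated_chart_admissible : @admissible_chart R d G translated_chart.
Proof.
move=> psi Apsi; split.
  rewrite chart_image_cap translated_chart_cod; exact: sinv.2.
rewrite setIC chart_image_cap.
have s1 : smoothG (chart_cod psi) (m \o chart_inv psi).
  have oc : open (chart_cod psi) by exact: open_chart_cod.
  apply: (@smoothG_mul _ _ _ _ _ (fun x => a * chart_inv psi x)%g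
    (fun=> b)) => //.
    apply: smoothG_mul => //; [exact: smoothG_cst|exact: smoothG_chart].
  exact: smoothG_cst.
set D := _ `&` _ => k.
have oD : open D.
  apply: open_preimI => //; first exact: open_chart_cod.
  exact: chart_inv_continuous.
apply: (@Ck_on_comp _ _ _ _ k D (f @` W) h (phi \o (m \o chart_inv psi))) => //.
- exact: findim_mx.
- by move=> x [_ []].
- by apply: Ck_onS (s1.2 phi Aphi k) => x [cx []].
Qed.

End TranslatedChart.

(** * The torsion set near one of its points *)

(** Both [P] and its complement are open relatively to [C], as unions of the
neighbourhoods on which membership in [P] is constant. *)
Lemma connected_locally_constant (T : topologicalType) (C P : set T) (x y : T) :
  connected C ->
  (forall q, C q -> exists N, [/\ open N, N q &
     forall z, C z -> N z -> (P z <-> P q)]) ->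
  C x -> C y -> P x -> P y.
Proof.
move=> conC loc Cx Cy Px.
suff /seteqP[_ /(_ y Cy) []] : C `&` P = C by [].
apply: conC; first by exists x.
- exists (\bigcup_(N in [set N | open N /\ C `&` N `<=` P]) N).
    by apply: bigcup_open => N [].
  apply/seteqP; split=> [q [Cq Pq]|q [Cq [N [_ NP] Nq]]]; split=> //;
    last exact: NP.
  have [N [oN Nq h]] := loc q Cq; exists N => //; split=> // z [Cz Nz].
  exact/(h z Cz Nz).
- exists (~` \bigcup_(N in [set N | open N /\ C `&` N `<=` ~` P]) N).
    by apply: open_closedC; apply: bigcup_open => N [].
  apply/seteqP; split=> [q [Cq Pq]|q [Cq nq]]; split=> //.
    by move=> [N [_ NP] Nq]; exact: (NP q (conj Cq Nq)).
  apply: contrapT => nPq; apply: nq.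
  have [N [oN Nq h]] := loc q Cq; exists N => //; split=> // z [Cz Nz] Pz.
  exact/nPq/(h z Cz Nz).
Qed.

Section Torsion.
Context {R : realType} {d : nat} {G : lieGroupType R d}.
Local Notation E := ('rV[R]_d).
Local Notation atlasG := (@atlas R d G).

(** For the matrices of [finite_order_split], [x *m U] and [x *m V] are, up to
a change of coordinates, the components of [x] in ker(A - 1) and im(A - 1).
The charts are given for all conjugates [g ^ c] at once, with one and the same
dimension [k] and codomain; this is what makes the dimension constant along a
component.  The second clause on [Psi x] says that the torsion points near [g]
are conjugate to [g]. *)
Lemma torsion_slice (g : G) n : (0 < n)%N -> (g ^+ n)%g = 1%g ->
  exists k (r : R) (Psi : E -> G), [/\ (k <= d)%N, 0 < r, Psi 0 = g,
    forall x, ball (0 : E) r x ->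
      ((Psi x ^+ n)%g = 1%g <-> forall i : 'I_d, (k <= i)%N -> x ord0 i = 0) /\
      ((Psi x ^+ n)%g = 1%g -> exists c, Psi x = (g ^ c)%g) &
    forall c : G, exists theta : chart G E, [/\ @admissible_chart R d G theta,
      chart_cod theta = ball (0 : E) r &
      forall x, ball (0 : E) r x -> chart_inv theta x = (Psi x ^ c)%g]].
Proof.
move=> n0 gn; have [phi Aphi d1] := @chart_at R d G 1%g.
pose A := adjoint_mx phi g.
have An : A ^+ n = 1 by exact: adjoint_mx_finite_order.
have [k [V [U [kd uT UN slice]]]] := finite_order_split n0 An.
pose t := shifted_chart_inv phi.
have tt : tangent phi t 1%:M by exact: tangent_shifted.
have tV : tangent phi (fun x => t (x *m V)) V.
  by have := tangent_mulmx V tt; rewrite mulmx1.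
have tU : tangent phi (fun x => t (x *m U)) U.
  by have := tangent_mulmx U tt; rewrite mulmx1.
(* The translate [g^-1 * Psi x], which takes values near the identity. *)
pose F x := ((t (x *m V) ^ g) * t (x *m U) * (t (x *m V))^-1)%g.
have tF : tangent phi F (V *m A + U - V).
  apply: (tangent_mul Aphi d1) (tangent_inv Aphi d1 tV).
  by apply: (tangent_mul Aphi d1) tU; exact: tangent_conj.
have [F0 cF [dF0 dF]] := tF.
pose K (x : E) := twisted_power g n (t (x *m U)).
have muc (M : 'M[R]_d) : continuous (mulmxr M : E -> E).
  exact/lin_continuous/findim_mx.
(* On [u = x *m U] the differential of [twisted_power g n (t u)] is the
   multiplication by [n >= 1], so that the remainder, at most |u| / 2, cannot
   cancel it unless [u = 0]. *)
have nearK : \forall x \near (0 : E), K x = 1%g -> x *m U = 0.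
  pose Kt u := twisted_power g n (t u).
  have [K0 cK [dK0 dK]] : tangent phi Kt (\sum_(j < n) A ^+ j).
    by have := tangent_twisted_power Aphi d1 g n tt; rewrite mul1mx.
  have half0 : 0 < (2^-1 : R) by rewrite invr_gt0.
  have /eqaddoP /(_ _ half0) := diff_locally dK0.
  rewrite dK => nK.
  pose Z := [set u : E | `|(phi \o Kt \o shift 0 - (cst ((phi \o Kt) 0) +
      (fun v => v *m \sum_(j < n) A ^+ j))) u| <= 2^-1 * `|u|].
  have nZ : nbhs (mulmxr U (0 : E)) Z by rewrite /= mul0mx; exact: nK.
  have nZU : \forall x \near (0 : E), Z (x *m U) := muc U 0 Z nZ.
  apply: filterS nZU => x; rewrite /Z /= !fctE /= addr0 K0.
  rewrite -[Kt _]/(K x) -mulmxA UN.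
  move=> le1 Kx.
  move: le1; rewrite Kx opprD addrA subrr add0r normrN -scalemxAr normrZ.
  rewrite ger0_norm ?ler0n// => le1.
  apply/eqP; rewrite -normr_le0.
  have n1 : 1 <= n%:R :> R by rewrite ler1n.
  have : 1 * `|x *m U| <= n%:R * `|x *m U| by rewrite ler_wpM2r.
  rewrite mul1r; lra.
have oc : open (chart_cod phi) by exact: open_chart_cod.
have sshift (M : 'M[R]_d) : smooth_on [set: E] (fun x : E => x *m M + phi 1%g).
  move=> j; apply: (@Ck_onD _ _ _ j setT (mulmxr M : E -> E) (fun=> phi 1%g)).
  - exact: openT.
  - exact: (@Ck_on_lin _ _ _ j [set: E] (mulmxr M) (muc M)).
  - exact: Ck_on_cst.
have codM (M : 'M[R]_d) :
    \forall x \near (0 : E), chart_cod phi (x *m M + phi 1%g).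
  have n1 : nbhs ((0 : E) *m M + phi 1%g) (chart_cod phi).
    rewrite mul0mx add0r; apply: open_nbhs_nbhs; split=> //.
    exact: chart_codP.
  exact: (sshift M 0%N (0 : E) (mem_set I) _ n1).
have [B [oB B0 BP]] : exists B : set E, [/\ open B, B 0 &
    forall x, B x -> [/\ chart_dom phi (F x), chart_cod phi (x *m V + phi 1%g),
       chart_cod phi (x *m U + phi 1%g) & (K x = 1%g -> x *m U = 0)]].
  have : nbhs (0 : E) [set x | [/\ chart_dom phi (F x),
       chart_cod phi (x *m V + phi 1%g), chart_cod phi (x *m U + phi 1%g) &
       (K x = 1%g -> x *m U = 0)]].
    have h1 := near_chart_dom d1 F0 cF; have h2 := codM V; have h3 := codM U.
    near=> x; split; near: x; [exact: h1|exact: h2|exact: h3|exact: nearK].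
  rewrite nbhsE => -[B [oB B0] BP]; exists B; split=> //.
have sF : smooth_on B (phi \o F).
  have st (M : 'M[R]_d) : (forall x, B x -> chart_cod phi (x *m M + phi 1%g)) ->
      smoothG B (fun x => t (x *m M)).
    move=> hM; apply: (@smoothG_comp _ _ _ _ _ B (chart_cod phi)
      (fun x => x *m M + phi 1%g) (chart_inv phi)) => //.
    - exact: findim_mx.
    - by move=> j; apply: Ck_onS (sshift M j).
    - exact: smoothG_chart.
  have sV : smoothG B (fun x => t (x *m V)) by apply: st => x /BP[].
  have sU : smoothG B (fun x => t (x *m U)) by apply: st => x /BP[].
  have [_ /(_ phi Aphi)] : smoothG B F.
    apply: smoothG_mul => //; last exact: smoothG_inv.
    by apply: smoothG_mul => //; exact: smoothG_conj.
  by move=> h j; apply: Ck_onS (h j) => x Bx; split=> //; have [] := BP x Bx.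
have [|r [h [r0 rB ofb hK sh]]] := smooth_inverse oB B0 sF.
  suff -> : jacobian (phi \o F) 0 = V *m A + U - V by [].
  apply/row_matrixP => i; rewrite !rowE /jacobian mul_rV_lin1.
  by rewrite dF.
have sF' : smooth_on (ball (0 : E) r) (phi \o F).
  by move=> j; apply: Ck_onS (sF j).
have Fcod : (phi \o F) @` ball (0 : E) r `<=` chart_cod phi.
  move=> _ [x /rB/BP[dx _ _ _] <-]; exact: chart_codP.
pose Psi x := (g * F x)%g.
have ThE x : Psi x = ((g * t (x *m U)) ^ (t (x *m V))^-1)%g.
  by rewrite /Psi /F !conjgE invgK !mulgA mulgV mul1g.
have t0 : t 0 = 1%g by case: tt.
have Ktriv x : x *m U = 0 -> K x = 1%g.
  move=> xU; rewrite /K xU t0; apply: (@mulgI _ (g ^+ n)%g).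
  by rewrite -twisted_powerE !mulg1.
have tors x : ball (0 : E) r x -> (Psi x ^+ n)%g = 1%g <-> x *m U = 0.
  move=> bx; have [_ _ _ Kx] := BP x (rB _ bx).
  rewrite ThE -conjXg twisted_powerE gn mul1g -/(K x).
  split=> [/eqP|/Ktriv ->]; last exact: conj1g.
  by rewrite conjg_eq1 => /eqP/Kx.
exists k, r, Psi; split=> //; first by rewrite /Psi F0 mulg1.
- move=> x bx; split; first exact: iff_trans (tors x bx) (slice x).
  move=> /(tors x bx) xU; exists (t (x *m V))^-1%g.
  by rewrite ThE xU t0 mulg1.
move=> c.
(* The point [(g * F x) ^ c] is sent to [F x] by [y |-> g^-1 * c * y * c^-1]. *)
exists (translated_chart Aphi (g^-1 * c)%g c^-1%g (ball_open _ _)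
  ofb Fcod hK sF' sh).
split.
- exact: translated_chart_admissible.
- exact: translated_chart_cod.
- move=> x bx; have [dx _ _ _] := BP x (rB _ bx).
  rewrite translated_chart_invE /= chart_domK//.
  by rewrite invgK invgM invgK /Psi conjgE !mulgA.
Unshelve. all: by end_near. Qed.
End Torsion.

(** * Connected components of the torsion set *)

Section Components.
Context {R : realType} {d : nat} {G : lieGroupType R d}.
Local Notation E := ('rV[R]_d).

Lemma torsion_set_closed n : closed (torsion_set G n).
Proof.
have cX : continuous (fun g : G => (g ^+ n)%g).
  elim: n => [|n IH] g.
    by move=> A nA; exact: (@cvg_cst G 1%g G (nbhs g)).
  have -> : (fun g : G => (g ^+ n.+1)%g) = (fun g : G => (g * g ^+ n)%g).
    by apply/funext => x; rewrite expgS.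
  apply: (@continuousG_mul _ _ _ _ (fun g : G => g)) => //.
  exact: IH.
have -> : torsion_set G n = (fun g : G => (g ^+ n)%g) @^-1` [set 1%g] by [].
apply: closed_comp => [g _|]; first exact: cX.
exact/accessible_closed_set1/hausdorff_accessible/(@manifold_hausdorff R d G).
Qed.

Lemma torsion_conj_nbhs n (q : G) : (0 < n)%N -> (q ^+ n)%g = 1%g ->
  exists N : set G, [/\ open N, N q &
    forall z, N z -> (z ^+ n)%g = 1%g -> exists h, z = (q ^ h)%g].
Proof.
move=> n0 qn; have [k [r [Psi [kd r0 T0 HT charts]]]] := torsion_slice n0 qn.
have [theta [_ cth ith]] := charts 1%g.
exists (chart_dom theta); split; first exact: chart_dom_open.
  have b0 : ball (0 : E) r 0 by exact: ballxx.
  by rewrite -(conjg1 q) -T0 -ith//; apply: chart_inv_dom; rewrite cth.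
move=> z dz; have bz : ball (0 : E) r (theta z).
  by rewrite -cth; exact: chart_codP.
rewrite -(chart_domK dz) ith// conjg1; exact: (HT _ bz).2.
Qed.

(** By [torsion_conj_nbhs], being conjugate to [g] is a locally constant
property on the torsion set. *)
Lemma torsion_component_conj n (g : G) p : (0 < n)%N -> (g ^+ n)%g = 1%g ->
  connected_component (torsion_set G n) g p -> exists c, p = (g ^ c)%g.
Proof.
move=> n0 gn Cp; pose P := [set p : G | exists c, p = (g ^ c)%g].
have sub := @connected_component_sub _ (torsion_set G n) g.
apply: (connected_locally_constant (P := P) (@component_connected _ _ _)
  _ _ Cp).
- move=> q /sub qn; have [N [oN Nq h]] := torsion_conj_nbhs n0 qn.
  exists N; split=> // z /sub zn Nz; have [c ->] := h z Nz zn.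
  split=> [[e]|[e ->]].
    move=> /(congr1 (fun y => y ^ c^-1)%g); rewrite conjgK -conjgM => ->.
    by eexists.
  by exists (e * c)%g; rewrite conjgM.
- exact: connected_component_refl.
- by exists 1%g; rewrite conjg1.
Qed.

(** The image under the inverse chart of the segment from 0 to [x] is
connected, contained in [S], and joins the two points. *)
Lemma slice_connected (theta : chart G E) (r : R) (S : set G) (L : set E)
    (x : E) :
  chart_cod theta = ball (0 : E) r ->
  (forall y, ball (0 : E) r y -> L y -> S (chart_inv theta y)) ->
  (forall (s : R) y, L y -> L (s *: y)) ->
  ball (0 : E) r x -> L x ->
  connected_component S (chart_inv theta 0) (chart_inv theta x).
Proof.
move=> cth LS Lscale bx Lx.
have bs (s : R) : 0 <= s <= 1 -> ball (0 : E) r (s *: x).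
  move=> /andP[s0 s1]; move: bx; rewrite -!ball_normE /= !sub0r !normrN normrZ.
  by apply: le_lt_trans; rewrite ger0_norm// ler_piMl.
pose path (s : R) := chart_inv theta (s *: x).
have cpath : {within `[0, 1], continuous path}.
  apply: continuous_in_subspaceT => s; rewrite inE /= in_itv /= => /bs bsx.
  have c1 : {for s *: x, continuous (chart_inv theta)}.
    by apply: chart_inv_continuous; apply: mem_set; move: bsx; rewrite -cth.
  exact: cvg_comp (@scalel_continuous _ _ x s) c1.
have conn := connected_continuous_connected (@segment_connected R 0 1) cpath.
have H : path @` `[0, 1] `<=` connected_component S (chart_inv theta 0).
  apply: connected_component_max conn.
    by exists 0; [rewrite /= in_itv /= lexx ler01|rewrite /path scale0r].
  move=> z [s]; rewrite /= in_itv /= => s01 <-.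
  by apply: LS; [exact: bs|exact: Lscale].
by apply: H; exists 1; [rewrite /= in_itv /= lexx ler01|rewrite /path scale1r].
Qed.

End Components.

Theorem corollary4p1 (R : realType) (d : nat) (G : lieGroupType R d) (n : nat)
    (Gconn : connected [set: G]) (npos : (0 < n)%N) (C : set G)
    (hC : torsion_components G n C) :
  closed_submanifold C.
Proof.
case: hC => g gn <-; split; last exact/component_closed/torsion_set_closed.
have [k [r [Psi [kd r0 T0 HT charts]]]] := torsion_slice npos gn.
exists k => // p Cp.
have [c pE] := torsion_component_conj npos gn Cp.
have [theta [adm cth ith]] := charts c.
have b0 : ball (0 : 'rV[R]_d) r 0 by exact: ballxx.
have th0 : chart_inv theta 0 = p by rewrite ith// T0.
exists theta; split=> //.
  by rewrite -th0; apply: chart_inv_dom; rewrite cth.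
rewrite chart_image_cap cth.
have tors x : ball (0 : 'rV[R]_d) r x ->
    torsion_set G n (chart_inv theta x) <->
    forall i : 'I_d, (k <= i)%N -> x ord0 i = 0.
  move=> bx; rewrite -(HT x bx).1 ith// /torsion_set /= -conjXg.
  by split=> [/eqP|->]; [rewrite conjg_eq1 => /eqP|exact: conj1g].
rewrite (same_connected_component Cp).
apply/seteqP; split=> x [bx].
  move=> Sx; split=> //.
  exact: (tors x bx).1 (connected_component_sub Sx).
move=> /= Lx; split=> //=.
pose L := [set y : 'rV[R]_d | forall i : 'I_d, (k <= i)%N -> y ord0 i = 0].
rewrite -th0; apply: (slice_connected (L := L) cth _ _ bx Lx).
- by move=> y by_ Ly; exact: (tors y by_).2 Ly.
- by move=> s y Ly i /Ly yi; rewrite mxE yi mulr0.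
Qed.
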